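(* Let $Q$ be a commutative ring, $R=Q/I$, $S$ an $R$-algebra, $M$ an $R$-module and $N$ an $S$-module. Let $A$ (with $A_0=Q$) and $G$ be $Q$-projective resolutions of $R$ and $M$, with an $A_\infty$-algebra structure $m$ and an $A_\infty$ $A$-module structure $m^G$, respectively. Set $\overline A=A\otimes S$, $\overline m_i=m_i\otimes S$ and $\overline m_i^G=m_i^G\otimes N$. In the Avramov spectral sequence $$E^0_{p,q}\cong\left(\overline A_+^{\otimes_Sp}\otimes_S(G\otimes N)\right)_q\Rightarrow\operatorname{Tor}^R_{p+q}(M,N),$$ an element $x\in E^0_p$ survives to $E^r_p$ if and only if there exist $x_i\in E^0_i$ for $i=p-r,\dots,p-1$ such that, with $x_p=x$, $$\sum_{i=1}^nt_i(x_{p-n+i})=0\quad\text{for }n=1,\dots,r.$$ In this case $d^r(x)$ is the image in $E^r_{p-r}$ of $$\sum_{i=1}^{r+1}t_i(x_{p-r-1+i})=\sum_{i=1}^{r+1}\sum_{j=0}^{p-r}\left(1^{\otimes j}\otimes\overline m_i\otimes1^{\otimes p-r-j}\right)(x_{p-r-1+i}),$$ where $\overline m_i$ means $\overline m_i^G$ when $j=p-r$.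
   Context: Conventions: $\otimes=\otimes_Q$. Complexes are graded homologically. $M[1]_n=M_{n-1}$, $d_{M[1]}=-d_M$, and $s:M\to M[1]$ is the degree $1$ map $s(m)=m$. Signs: $(f\otimes g)(x\otimes y)=(-1)^{|g||x|}f(x)\otimes g(y)$. $A_+=A_{\ge 1}$. An $A_\infty$-algebra structure on $A$ is a sequence of degree $-1$ maps $m_n:A_+[1]^{\otimes n}\to A_+[1]$, $n\ge1$, such that $m_1$ is the differential of the complex $A_+[1]$; $m_1m_2+m_2(m_1\otimes1+1\otimes m_1)=d_1^A\otimes1-1\otimes d_1^A$, where $d_1^A:A_1\to A_0=Q$ is viewed as a degree $-2$ map $A_+[1]\to A_0$ and $A_0\otimes A_+[1]=A_+[1]=A_+[1]\otimes A_0$; and $\sum_{i=1}^n\sum_{j=0}^{n-i}m_{n-i+1}(1^{\otimes j}\otimes m_i\otimes1^{\otimes n-i-j})=0$ for all $n\ge3$. Given $(m_n)$, an $A_\infty$ $A$-module structure on $G$ is a sequence of degree $-1$ maps $m_n^G:A_+[1]^{\otimes n-1}\otimes G\to G$, $n\ge1$, such that $m_1^G=d^G$; $m_1^Gm_2^G+m_2^G(m_1\otimes1+1\otimes m_1^G)=d_1^A\otimes1$; and $\sum_{i=1}^n\sum_{j=0}^{n-i}m^G_{n-i+1}(1^{\otimes j}\otimes m_i\otimes1^{\otimes n-i-j})=0$ for all $n\ge3$, where $m_i$ means $m_i^G$ when $j=n-i$. The bar resolution $R\otimes\operatorname{Bar}A\otimes G=\bigoplus_{p\ge0}R\otimes A_+[1]^{\otimes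 p}\otimes G$ has $R$-linear differential which on the $p$-th summand is $R\otimes\sum_{i=1}^{p+1}\sum_{j=0}^{p-i+1}1^{\otimes j}\otimes m_i\otimes1^{\otimes p-i-j+1}$, where $m_i$ means $m_i^G$ when $j=p-i+1$; it is an $R$-projective resolution of $M$. The Avramov spectral sequence is that of the complex $X=(R\otimes\operatorname{Bar}A\otimes G)\otimes_RN\cong\bigoplus_{p\ge0}E^0_p$, $E^0_p=\overline A_+[1]^{\otimes_Sp}\otimes_S(G\otimes N)\;(\cong A_+[1]^{\otimes p}\otimes G\otimes N)$, filtered by number of bars, $F_pX=\bigoplus_{l\le p}E^0_l$, with $E^0_{p,q}=(E^0_p)_{p+q}$. Define $t_i:E^0_p\to E^0_{p-i+1}$ by $t_i=\sum_{j=0}^{p-i+1}1^{\otimes j}\otimes\overline m_i\otimes1^{\otimes p-i-j+1}$, with $\overline m_i=m_i\otimes S$ for $j<p-i+1$ and $\overline m_i=m_i^G\otimes N$ for $j=p-i+1$; then $d=t_1+\dots+t_{p+1}$ on $E^0_p$. Elements $x_i$ with $i<0$ are $0$. With $Z^r_p=F_pX\cap d^{-1}F_{p-r}X$ and $B^r_p=d(Z^r_{p+r})$, $E^r_p=Z^r_p/(Z^{r-1}_{p-1}+B^{r-1}_p)$, regarded as a subquotient of $E^0_p=F_pX/F_{p-1}X$; ''$x$ survives to $E^r_p$'' means that $x$ is the $E^0_p$-component of an element of $Z^r_p$. *)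

(* Defs.v *)
From HB Require Import structures.
From mathcomp Require Import all_boot all_order all_algebra.
From mathcomp Require Import finmap boolp classical_sets cardinality fsbigop.

Set Implicit Arguments.
Unset Strict Implicit.
Unset Printing Implicit Defensive.

Import GRing.Theory.
Local Open Scope ring_scope.
Local Open Scope classical_set_scope.

Section DirectSum.
Variables (I : choiceType) (V : I -> zmodType).

Record dsum : Type := DSum {
  dsum_fun :> forall i, V i;
  dsum_finite : finite_set [set i | dsum_fun i <> 0] }.

Lemma dsumP (y z : dsum) : (forall i, y i = z i) -> y = z.
Proof.
case: y z => [y Hy] [z Hz] /= yz.
have E : y = z by apply: functional_extensionality_dep.
by rewrite E in Hy *; congr DSum; apply: Prop_irrelevance.
Qed.

HB.instance Definition _ := gen_eqMixin dsum.
HB.instance Definition _ := gen_choiceMixin dsum.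

Fact dsum0_finite : finite_set [set i | (0 : V i) <> 0].
Proof. by apply: (sub_finite_set _ (finite_set0 _)) => i /=; apply. Qed.

Fact dsumN_finite (y : dsum) : finite_set [set i | - y i <> 0].
Proof.
by apply: (sub_finite_set _ (dsum_finite y)) => i /= + yi; rewrite yi oppr0.
Qed.

Fact dsumD_finite (y z : dsum) : finite_set [set i | y i + z i <> 0].
Proof.
have fU : finite_set ([set i | y i <> 0] `|` [set i | z i <> 0]).
  by rewrite finite_setU; split; apply: dsum_finite.
apply: (sub_finite_set _ fU) => i /= yz0.
have [yi|] := pselect (y i = 0); last by left.
by right=> zi; apply: yz0; rewrite yi zi addr0.
Qed.

Definition dsum0 := DSum dsum0_finite.
Definition dsumN (y : dsum) := DSum (dsumN_finite y).
Definition dsumD (y z : dsum) := DSum (dsumD_finite y z).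

Fact dsumA : associative dsumD.
Proof. by move=> x y z; apply: dsumP => i /=; rewrite addrA. Qed.
Fact dsumC : commutative dsumD.
Proof. by move=> x y; apply: dsumP => i /=; rewrite addrC. Qed.
Fact dsum0D : left_id dsum0 dsumD.
Proof. by move=> x; apply: dsumP => i /=; rewrite add0r. Qed.
Fact dsumND : left_inverse dsum0 dsumN dsumD.
Proof. by move=> x; apply: dsumP => i /=; rewrite addNr. Qed.

HB.instance Definition _ :=
  GRing.isZmodule.Build dsum dsumA dsumC dsum0D dsumND.

Lemma dsum0E i : (0 : dsum) i = 0. Proof. by []. Qed.
Lemma dsumDE (y z : dsum) i : (y + z) i = y i + z i. Proof. by []. Qed.
Lemma dsumNE (y : dsum) i : (- y) i = - y i. Proof. by []. Qed.
Lemma dsumBE (y z : dsum) i : (y - z) i = y i - z i. Proof. by []. Qed.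

Definition inj_fun i (x : V i) j : V j :=
  if pselect (i = j) is left e then ecast j (V j) e x else 0.

Fact inj_finite i (x : V i) : finite_set [set j | inj_fun x j <> 0].
Proof.
apply: (sub_finite_set _ (finite_set1 i)) => j /=; rewrite /inj_fun.
by case: pselect => // -[].
Qed.

Definition dsum_inj i (x : V i) : dsum := DSum (inj_finite x).

Lemma dsum_injE i (x : V i) : dsum_inj x i = x.
Proof.
rewrite /= /inj_fun; case: pselect => // e.
by rewrite (Prop_irrelevance e (erefl i)).
Qed.

Lemma dsum_inj_neq i j (x : V i) : i <> j -> dsum_inj x j = 0.
Proof. by rewrite /= /inj_fun; case: pselect. Qed.

Fact dsum_inj_additive i : zmod_morphism (@dsum_inj i).
Proof.
move=> x y; apply: dsumP => j; rewrite dsumBE /= /inj_fun.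
by case: pselect => [e|_]; [case: _ / e | rewrite subr0].
Qed.
HB.instance Definition _ i :=
  GRing.isZmodMorphism.Build (V i) dsum (@dsum_inj i) (@dsum_inj_additive i).

Section Lift.
Variables (Z : zmodType) (f : forall i, V i -> Z).

Definition dsum_lift (y : dsum) : Z := \sum_(i \in [set: I]) f (y i).

Hypothesis f_additive : forall i, zmod_morphism (@f i).

Let f0 i : @f i 0 = 0.
Proof. by have := f_additive (0 : V i) 0; rewrite !subrr. Qed.

Lemma dsum_lift_seq (A : set I) (y : dsum) : finite_set A ->
  [set i | y i <> 0] `<=` A -> dsum_lift y = \sum_(i \in A) f (y i).
Proof.
move=> Afin Ay; rewrite /dsum_lift.
symmetry; apply: fsbig_widen => // i [_ /= nAi]; apply/eqP.
have [->|yi] := pselect (y i = 0); first by rewrite f0.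
by case: nAi; apply: Ay.
Qed.

Lemma dsum_lift_additive : zmod_morphism dsum_lift.
Proof.
move=> y z; pose A := [set i | y i <> 0] `|` [set i | z i <> 0].
have fA : finite_set A by rewrite finite_setU; split; apply: dsum_finite.
rewrite !(@dsum_lift_seq A) //; first last.
- move=> i /= yz0; have [yi|] := pselect (y i = 0); last by left.
  by right=> zi; apply: yz0; rewrite yi zi subr0.
- by move=> i; left.
- by move=> i; right.
rewrite !(fsbig_finite _ _ fA) /= -sumrB; apply: eq_bigr => i _.
exact: f_additive.
Qed.

Lemma dsum_lift_inj i (x : V i) : dsum_lift (dsum_inj x) = f x.
Proof.
rewrite (@dsum_lift_seq [set i]) ?fsbig_set1 ?dsum_injE // => j /=.
by rewrite /inj_fun; case: pselect => // -[].
Qed.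

End Lift.

Lemma dsum_ind (P : dsum -> Prop) :
  P 0 -> (forall y z, P y -> P z -> P (y + z)) ->
  (forall i (x : V i), P (dsum_inj x)) -> forall y, P y.
Proof.
move=> P0 PD Pinj y; have fA := dsum_finite y.
have -> : y = \sum_(i <- fset_set [set i | y i <> 0]) dsum_inj (y i).
  apply: dsumP => j.
  have -> r : (\sum_(i <- r) dsum_inj (y i)) j = \sum_(i <- r) dsum_inj (y i) j.
    elim: r => [|i r IHr]; first by rewrite !big_nil.
    by rewrite !big_cons -IHr.
  rewrite -(fsbig_finite _ _ fA) (fsbig_widen _ [set: I]) //; last first.
    by move=> i [_ /contrapT yi]; rewrite /preimage /mkset yi raddf0.
  rewrite -(fsbig_widen [set j]) //; last first.
    by move=> i [_ /= ij]; rewrite /inj_fun; case: pselect.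
  by rewrite fsbig_set1 dsum_injE.
by elim/big_ind: _.
Qed.

End DirectSum.

Arguments dsum_inj {I V} i x.

(** The module [\bigoplus_n V n] underlying a graded module [V]. *)
Section Total.
Variables (K : pzRingType) (V : nat -> lmodType K).

Definition gtotal : Type := dsum (fun n => V n : zmodType).

HB.instance Definition _ := GRing.Zmodule.on gtotal.

Fact gtotal_scale_finite (a : K) (y : gtotal) :
  finite_set [set n | a *: y n <> 0].
Proof.
by apply: (sub_finite_set _ (dsum_finite y)) => n /= + yn; rewrite yn scaler0.
Qed.

Definition gtotal_scale a (y : gtotal) : gtotal := DSum (gtotal_scale_finite a y).

Fact gtotal_scaleA a b y : gtotal_scale a (gtotal_scale b y) = gtotal_scale (a * b) y.
Proof. by apply: dsumP => n /=; rewrite scalerA. Qed.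
Fact gtotal_scale1 : left_id 1 gtotal_scale.
Proof. by move=> y; apply: dsumP => n /=; rewrite scale1r. Qed.
Fact gtotal_scaleDr : right_distributive gtotal_scale +%R.
Proof. by move=> a y z; apply: dsumP => n /=; rewrite scalerDr. Qed.
Fact gtotal_scaleDl y : {morph gtotal_scale^~ y : a b / a + b}.
Proof. by move=> a b; apply: dsumP => n /=; rewrite scalerDl. Qed.

HB.instance Definition _ := GRing.Zmodule_isLmodule.Build K gtotal
  gtotal_scaleA gtotal_scale1 gtotal_scaleDr gtotal_scaleDl.

(** [V n] sits in degree [n + s]. *)
Definition homogeneous (s : nat) (e : int) (y : gtotal) : Prop :=
  forall n, (n + s)%N%:Z <> e -> y n = 0.

Fact koszul_finite (s : nat) (y : gtotal) :
  finite_set [set n | (-1) ^+ (n + s) *: y n <> 0].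
Proof.
by apply: (sub_finite_set _ (dsum_finite y)) => n /= + yn; rewrite yn scaler0.
Qed.

(** [y |-> (-1)^|y| y], the sign a map of odd degree acquires on moving past [y] *)
Definition koszul (s : nat) (y : gtotal) : gtotal := DSum (koszul_finite s y).

End Total.

Section Span.
Variables (F : zmodType) (D : set F).

Definition span_mem (x : F) : Prop := forall P : set F,
  P 0 -> (forall y z, P y -> P z -> P (y - z)) -> D `<=` P -> P x.

Definition span : {pred F} := fun x => `[< span_mem x >].

Fact span_zmod_closed : zmod_closed span.
Proof.
split; first by apply/asboolP => P P0 PB PD.
move=> x y /asboolP xD /asboolP yD; apply/asboolP => P P0 PB PD.
exact: PB (xD P P0 PB PD) (yD P P0 PB PD).
Qed.
HB.instance Definition _ := GRing.isZmodClosed.Build F span span_zmod_closed.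

Definition zquot : Type := Quotient.quot span.
HB.instance Definition _ := GRing.Zmodule.on zquot.

Definition zproj (x : F) : zquot := (\pi_(Quotient.quot span) x)%qT.
Definition zrepr (q : zquot) : F := repr (q : Quotient.quot span).

End Span.

Section ZquotTheory.
Variables (F : zmodType) (D : set F).

Fact zproj_additive : zmod_morphism (@zproj F D).
Proof. by move=> x y; rewrite /zproj raddfB. Qed.
HB.instance Definition _ :=
  GRing.isZmodMorphism.Build F (zquot D) (@zproj F D) zproj_additive.

Lemma zreprK (q : zquot D) : zproj D (zrepr q) = q.
Proof. exact: reprK. Qed.

Lemma zproj_eq (x y : F) : zproj D x = zproj D y <-> span_mem D (x - y).
Proof.
split=> [/eqP|xy]; last apply/eqP.
  by rewrite -Quotient.idealrBE => /asboolP.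
by rewrite -Quotient.idealrBE; apply/asboolP.
Qed.

Lemma zproj_rel (x y : F) : D (x - y) -> zproj D x = zproj D y.
Proof. by move=> Dxy; apply/zproj_eq => P _ _; apply. Qed.

Definition zquot_lift (Z : zmodType) (f : F -> Z) (q : zquot D) : Z :=
  f (zrepr q).

Lemma zquot_lift_proj (Z : zmodType) (f : F -> Z) x :
  zmod_morphism f -> (forall x, D x -> f x = 0) ->
  zquot_lift f (zproj D x) = f x.
Proof.
move=> fB fD; apply/eqP; rewrite -subr_eq0; apply/eqP; rewrite -fB.
have /zproj_eq xD := zreprK (zproj D x).
apply: (xD [set y | f y = 0]) => //=; first by have := fB 0 0; rewrite !subrr.
by move=> y z fy fz; rewrite fB fy fz subrr.
Qed.

End ZquotTheory.

Definition upd (p : nat) (T : Type) (v : p.-tuple T) (k : 'I_p) (u : T) :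
  p.-tuple T := [tuple if l == k then u else tnth v l | l < p].

Section Tensor.
Variables (K : pzRingType) (U W : lmodType K) (ra : U -> K -> U) (p : nat).

(** [f] is additive in each variable and compatible with the action of [K]
    between neighbours; [ra] is the right action of [K] on [U]. *)
Record balanced (Z : zmodType) (f : p.-tuple U -> W -> Z) : Prop := Balanced {
  balanced_addl : forall v k u u' w,
    f (upd v k (u + u')) w = f (upd v k u) w + f (upd v k u') w;
  balanced_addr : forall v w w', f v (w + w') = f v w + f v w';
  balanced_mid : forall v (k l : 'I_p) a w, l = k.+1 :> nat ->
    f (upd v k (ra (tnth v k) a)) w = f (upd v l (a *: tnth v l)) w;
  balanced_last : forall v (k : 'I_p) a w, p = k.+1 ->
    f (upd v k (ra (tnth v k) a)) w = f v (a *: w) }.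

Definition tensor_free : zmodType :=
  dsum (fun _ : p.-tuple U * W => int : zmodType).

Definition tensor_symb (v : p.-tuple U) (w : W) : tensor_free :=
  dsum_inj (v, w) (1 : int).

Inductive tensor_rel : tensor_free -> Prop :=
| Tensor_addl v k u u' w : tensor_rel (tensor_symb (upd v k (u + u')) w -
    (tensor_symb (upd v k u) w + tensor_symb (upd v k u') w))
| Tensor_addr v w w' : tensor_rel (tensor_symb v (w + w') -
    (tensor_symb v w + tensor_symb v w'))
| Tensor_mid v (k l : 'I_p) a w of l = k.+1 :> nat :
    tensor_rel (tensor_symb (upd v k (ra (tnth v k) a)) w -
                tensor_symb (upd v l (a *: tnth v l)) w)
| Tensor_last v (k : 'I_p) a w of p = k.+1 :
    tensor_rel (tensor_symb (upd v k (ra (tnth v k) a)) w -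
                tensor_symb v (a *: w)).

(** The abelian group [U (x)_K ... (x)_K U (x)_K W], with [p] factors [U]. *)
Definition tensor : Type := zquot tensor_rel.
HB.instance Definition _ := GRing.Zmodule.on tensor.

(** [pure v w] is [v_0 (x) ... (x) v_(p-1) (x) w] *)
Definition pure (v : p.-tuple U) (w : W) : tensor :=
  zproj tensor_rel (tensor_symb v w).

Lemma pure_balanced : balanced pure.
Proof.
split=> [v k u u' w|v w w'|v k l a w lk|v k a w pk]; rewrite /pure.
- by rewrite -[RHS]raddfD; apply/zproj_rel/Tensor_addl.
- by rewrite -[RHS]raddfD; apply/zproj_rel/Tensor_addr.
- exact/zproj_rel/Tensor_mid.
- exact/zproj_rel/Tensor_last.
Qed.

Lemma tensor_ind (P : tensor -> Prop) : P 0 ->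
  (forall x y, P x -> P y -> P (x - y)) -> (forall v w, P (pure v w)) ->
  forall x, P x.
Proof.
move=> P0 PB Ppure x; rewrite -(zreprK x).
have PN y : P y -> P (- y) by move=> Py; rewrite -sub0r; apply: PB.
have PD y z : P y -> P z -> P (y + z).
  by move=> Py Pz; rewrite -[z]opprK; apply/PB/PN.
elim/dsum_ind: (zrepr x) => [|y z Py Pz|[v w] a]; rewrite ?raddf0 ?raddfD //.
  exact: PD.
have Pn n : P (zproj tensor_rel (dsum_inj (v, w) (n%:Z : int))).
  elim: n => [|n IHn]; first by rewrite !raddf0.
  by rewrite -addn1 PoszD !raddfD; apply: PD => //; apply: Ppure.
case: a => n; first exact: Pn.
by rewrite NegzE !raddfN; apply/PN/Pn.
Qed.

Section TensorLift.
Variables (Z : zmodType) (f : p.-tuple U -> W -> Z).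

Definition free_lift : tensor_free -> Z := dsum_lift (fun vw a => f vw.1 vw.2 *~ a).

Fact free_lift_additive : zmod_morphism free_lift.
Proof. by apply: dsum_lift_additive => vw a b; rewrite mulrzBr. Qed.

Lemma free_lift_symb v w : free_lift (tensor_symb v w) = f v w.
Proof.
rewrite /free_lift dsum_lift_inj ?mulr1z // => vw a b.
by rewrite mulrzBr.
Qed.

Hypothesis fbal : balanced f.

Fact free_lift_rel x : tensor_rel x -> free_lift x = 0.
Proof.
pose g : {additive tensor_free -> Z} :=
  HB.pack free_lift (GRing.isZmodMorphism.Build _ _ _ free_lift_additive).
have gE v w : g (tensor_symb v w) = f v w := free_lift_symb v w.
change (tensor_rel x -> g x = 0).
case=> *; rewrite raddfB ?(raddfD g) !gE; apply/eqP; rewrite subr_eq0; apply/eqP.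
- exact: balanced_addl.
- exact: balanced_addr.
- exact: balanced_mid.
- exact: balanced_last.
Qed.

Definition balanced_lift : tensor -> Z := zquot_lift free_lift.

Lemma balanced_lift_pure v w : balanced_lift (pure v w) = f v w.
Proof.
rewrite /balanced_lift /pure zquot_lift_proj ?free_lift_symb //.
  exact: free_lift_additive.
exact: free_lift_rel.
Qed.

Fact balanced_lift_additive : zmod_morphism balanced_lift.
Proof.
move=> x y; rewrite -(zreprK x) -(zreprK y) -[in LHS]raddfB /balanced_lift.
rewrite !zquot_lift_proj; do ?[exact: free_lift_additive|exact: free_lift_rel].
Qed.

Definition balanced_lift_map : {additive tensor -> Z} :=
  HB.pack balanced_lift
    (GRing.isZmodMorphism.Build _ _ _ balanced_lift_additive).

End TensorLift.

(** The zero map is a default for [f] not [balanced]: see [tensor_liftE]. *)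
Definition tensor_lift (Z : zmodType) (f : p.-tuple U -> W -> Z) :
  {additive tensor -> Z} :=
  if pselect (balanced f) is left fbal then balanced_lift_map fbal else \0.

Lemma tensor_liftE (Z : zmodType) (f : p.-tuple U -> W -> Z) v w :
  balanced f -> tensor_lift f (pure v w) = f v w.
Proof.
by rewrite /tensor_lift; case: pselect => // fbal _; apply: balanced_lift_pure.
Qed.

Lemma tensor_ext (Z : zmodType) (f g : {additive tensor -> Z}) :
  (forall v w, f (pure v w) = g (pure v w)) -> f =1 g.
Proof.
move=> fg; apply: tensor_ind => [|x y fx fy|//]; first by rewrite !raddf0.
by rewrite !raddfB fx fy.
Qed.

End Tensor.

Section TensorModule.
Variables (Q : comPzRingType) (V W : lmodType Q) (p : nat).

(** [V (x)_Q ... (x)_Q V (x)_Q W], with [p] factors [V], as a [Q]-module *)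
Definition qtensor : Type := tensor W (fun (v : V) (a : Q) => a *: v) p.
HB.instance Definition _ := GRing.Zmodule.on qtensor.

Definition qpure (v : p.-tuple V) (w : W) : qtensor := pure _ v w.

Definition qtensor_scale (a : Q) (x : qtensor) : qtensor :=
  tensor_lift _ (fun v w => qpure v (a *: w)) x.

Lemma qtensor_scale_pure a v w :
  qtensor_scale a (qpure v w) = qpure v (a *: w).
Proof.
apply: tensor_liftE; have [addl addr mid last] := @pure_balanced _ _ W
  (fun (v : V) (a : Q) => a *: v) p.
split=> [v0 k u u' w0|v0 w0 w'|v0 k l b w0 lk|v0 k b w0 pk].
- exact: addl.
- by rewrite scalerDr; apply: addr.
- exact: mid.
- by rewrite [RHS]/qpure scalerA mulrC -scalerA; apply: last.
Qed.

Fact qtensor_scaleDr : right_distributive qtensor_scale +%R.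
Proof. by move=> a x y; rewrite /qtensor_scale raddfD. Qed.

Lemma qtensor_ind (P : qtensor -> Prop) : P 0 ->
  (forall x y, P x -> P y -> P (x - y)) -> (forall v w, P (qpure v w)) ->
  forall x, P x.
Proof. exact: tensor_ind. Qed.

Fact qtensor_scaleB a x y :
  qtensor_scale a (x - y) = qtensor_scale a x - qtensor_scale a y.
Proof. exact: raddfB. Qed.

Fact qtensor_scale0 a : qtensor_scale a 0 = 0.
Proof. exact: raddf0. Qed.

Lemma qpureD v w w' : qpure v (w + w') = qpure v w + qpure v w'.
Proof. exact: balanced_addr (pure_balanced _ _ _) v w w'. Qed.

Fact qtensor_scaleA a b x :
  qtensor_scale a (qtensor_scale b x) = qtensor_scale (a * b) x.
Proof.
elim/qtensor_ind: x => [|x y ihx ihy|v w]; first by rewrite !qtensor_scale0.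
  by rewrite !qtensor_scaleB ihx ihy.
by rewrite !qtensor_scale_pure scalerA.
Qed.

Fact qtensor_scale1 : left_id 1 qtensor_scale.
Proof.
elim/qtensor_ind => [|x y ihx ihy|v w]; first by rewrite !qtensor_scale0.
  by rewrite !qtensor_scaleB ihx ihy.
by rewrite !qtensor_scale_pure scale1r.
Qed.

Fact qtensor_scaleDl x : {morph qtensor_scale^~ x : a b / a + b}.
Proof.
move=> a b; elim/qtensor_ind: x => [|x y ihx ihy|v w].
- by rewrite !qtensor_scale0 addr0.
- by rewrite !qtensor_scaleB ihx ihy opprD addrACA.
- by rewrite !qtensor_scale_pure scalerDl qpureD.
Qed.

HB.instance Definition _ := GRing.Zmodule_isLmodule.Build Q qtensor
  qtensor_scaleA qtensor_scale1 qtensor_scaleDr qtensor_scaleDl.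

End TensorModule.

(** [S] is an associative unital [K]-algebra through [amap] *)
Record algebra_map (K S : pzRingType) := AlgebraMap {
  amap :> {rmorphism K -> S};
  amap_central : forall a s, amap a * s = s * amap a }.

Definition algebra_map_comp (Q R S : pzRingType) (pi : {rmorphism Q -> R})
    (sigma : algebra_map R S) : algebra_map Q S :=
  @AlgebraMap Q S (sigma \o pi : {rmorphism Q -> S})
    (fun a s => amap_central sigma (pi a) s).

Definition restriction (Q S : pzRingType) (f : algebra_map Q S)
  (N : lmodType S) : Type := N.

Section Restriction.
Variables (Q S : pzRingType) (f : algebra_map Q S) (N : lmodType S).

HB.instance Definition _ := GRing.Zmodule.copy (restriction f N) N.

Definition restriction_scale (a : Q) (n : restriction f N) : restriction f N :=
  f a *: (n : N).

Fact restriction_scaleA a b n :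
  restriction_scale a (restriction_scale b n) = restriction_scale (a * b) n.
Proof. by rewrite /restriction_scale scalerA rmorphM. Qed.
Fact restriction_scale1 : left_id 1 restriction_scale.
Proof. by move=> n; rewrite /restriction_scale rmorph1 scale1r. Qed.
Fact restriction_scaleDr : right_distributive restriction_scale +%R.
Proof. by move=> a x y; apply: scalerDr. Qed.
Fact restriction_scaleDl n : {morph restriction_scale^~ n : a b / a + b}.
Proof. by move=> a b; rewrite /restriction_scale rmorphD scalerDl. Qed.

HB.instance Definition _ := GRing.Zmodule_isLmodule.Build Q (restriction f N)
  restriction_scaleA restriction_scale1 restriction_scaleDr restriction_scaleDl.

End Restriction.

Section BaseChange.
Variables (Q : comPzRingType) (S : pzRingType) (f : algebra_map Q S).
Variables (U : lmodType Q) (N : lmodType S).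

(** [U (x)_Q N], with [S] acting on [N] *)
Definition bchange : Type := qtensor U (restriction f N) 1.
HB.instance Definition _ := GRing.Zmodule.on bchange.

Definition bpure (u : U) (n : N) : bchange :=
  qpure [tuple u] (n : restriction f N).

Definition bchange_lift (Z : zmodType) (g : U -> N -> Z) :
  {additive bchange -> Z} := 
    tensor_lift _ (fun (v : 1.-tuple U) (n : restriction f N) => g (thead v) n).

Lemma upd1 (T : Type) (v : 1.-tuple T) k a : upd v k a = [tuple a].
Proof.
by apply: eq_from_tnth => l; rewrite tnth_mktuple !ord1 eqxx tnth0.
Qed.

Lemma bpureDl u u' n : bpure (u + u') n = bpure u n + bpure u' n.
Proof.
have := balanced_addl (pure_balanced (restriction f N)
  (fun (v : U) (a : Q) => a *: v) 1) [tuple u] ord0 u u' (n : restriction f N).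
by rewrite !upd1.
Qed.

Lemma bpureDr u n n' : bpure u (n + n') = bpure u n + bpure u n'.
Proof. exact: qpureD. Qed.

Lemma bpureZ a u n : bpure (a *: u) n = bpure u (f a *: n).
Proof.
have /= := balanced_last (pure_balanced (restriction f N)
  (fun (v : U) (a : Q) => a *: v) 1) [tuple u] a (n : restriction f N)
  (erefl : 1%N = (ord0 : 'I_1).+1).
by rewrite upd1 tnth0 /bpure /qpure => ->.
Qed.

Lemma bchange_liftE (Z : zmodType) (g : U -> N -> Z) u n :
  (forall u u' n, g (u + u') n = g u n + g u' n) ->
  (forall u n n', g u (n + n') = g u n + g u n') ->
  (forall a u n, g (a *: u) n = g u (f a *: n)) ->
  bchange_lift g (bpure u n) = g u n.
Proof.
move=> gDl gDr gZ; rewrite /bchange_lift /bpure /qpure tensor_liftE //.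
split=> [v k u0 u' n0|v n0 n'|v k l a n0|v k a n0 _]; rewrite ?upd1.
- exact: gDl.
- exact: gDr.
- by rewrite !ord1.
- by rewrite gZ ord1.
Qed.

Lemma bchange_ind (P : bchange -> Prop) : P 0 ->
  (forall x y, P x -> P y -> P (x - y)) -> (forall u n, P (bpure u n)) ->
  forall x, P x.
Proof.
move=> P0 PB Pp; apply: tensor_ind => // v n; have := Pp (thead v) n.
rewrite /bpure /qpure (_ : [tuple thead v] = v) //.
by apply: eq_from_tnth => l; rewrite !ord1 tnth0.
Qed.

Definition bchange_scale (s : S) (x : bchange) : bchange :=
  bchange_lift (fun u n => bpure u (s *: n)) x.

Lemma bchange_scale_pure s u n :
  bchange_scale s (bpure u n) = bpure u (s *: n).
Proof.
apply: bchange_liftE => [u0 u' n0|u0 n0 n'|a u0 n0].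
- exact: bpureDl.
- by rewrite scalerDr bpureDr.
- by rewrite bpureZ !scalerA amap_central.
Qed.

Fact bchange_scaleB a x y :
  bchange_scale a (x - y) = bchange_scale a x - bchange_scale a y.
Proof. exact: raddfB. Qed.
Fact bchange_scale0 a : bchange_scale a 0 = 0.
Proof. exact: raddf0. Qed.
Fact bchange_scaleDr : right_distributive bchange_scale +%R.
Proof. by move=> a x y; rewrite /bchange_scale raddfD. Qed.

Fact bchange_scaleA a b x :
  bchange_scale a (bchange_scale b x) = bchange_scale (a * b) x.
Proof.
elim/bchange_ind: x => [|x y ihx ihy|v w]; first by rewrite !bchange_scale0.
  by rewrite !bchange_scaleB ihx ihy.
by rewrite !bchange_scale_pure scalerA.
Qed.

Fact bchange_scale1 : left_id 1 bchange_scale.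
Proof.
elim/bchange_ind => [|x y ihx ihy|v w]; first by rewrite !bchange_scale0.
  by rewrite !bchange_scaleB ihx ihy.
by rewrite !bchange_scale_pure scale1r.
Qed.

Fact bchange_scaleDl x : {morph bchange_scale^~ x : a b / a + b}.
Proof.
move=> a b; elim/bchange_ind: x => [|x y ihx ihy|v w].
- by rewrite !bchange_scale0 addr0.
- by rewrite !bchange_scaleB ihx ihy opprD addrACA.
- by rewrite !bchange_scale_pure scalerDl bpureDr.
Qed.

HB.instance Definition _ := GRing.Zmodule_isLmodule.Build S bchange
  bchange_scaleA bchange_scale1 bchange_scaleDr bchange_scaleDl.

Lemma bpureZr s u n : s *: bpure u n = bpure u (s *: n).
Proof. exact: bchange_scale_pure. Qed.

End BaseChange.

Section TensorOverS.
Variables (Q : comPzRingType) (S : pzRingType) (f : algebra_map Q S).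
Variables (V W : lmodType Q) (N : lmodType S).

Definition bchange_rmul (x : bchange f V S^o) (s : S) : bchange f V S^o :=
  bchange_lift f (fun (v : V) (t : S^o) => bpure f v (t * s : S^o)) x.

(** [(V (x) S) (x)_S ... (x)_S (V (x) S) (x)_S (W (x) N)], with [p] factors
    [V (x) S]; only an abelian group, as [S] need not be commutative *)
Definition stensor (p : nat) : zmodType :=
  tensor (bchange f W N) bchange_rmul p.

Definition spure p (v : p.-tuple (bchange f V S^o)) (w : bchange f W N) :
  stensor p := pure bchange_rmul v w.

(** [g] is [phi (x) N] under the identification of [stensor p] with
    [(V (x) ... (x) V (x) W) (x) N]. *)
Definition extends_scalars p (phi : qtensor V W p -> W)
    (g : stensor p -> bchange f W N) : Prop :=
  forall (v : p.-tuple V) (s : p.-tuple S) (w : W) (n : N),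
    g (spure [tuple bpure f (tnth v k) (tnth s k : S^o) | k < p] (bpure f w n)) =
    bpure f (phi (qpure v w)) ((\prod_(k < p) tnth s k) *: n).

End TensorOverS.

Section ExtensionExists.
Variables (Q : comPzRingType) (S : pzRingType) (f : algebra_map Q S).
Variables (V W : lmodType Q) (N : lmodType S).
Local Notation SV := (bchange f V S^o).
Local Notation T := (qtensor V W).

Definition qcons p (v : V) (t : T p) : T p.+1 :=
  tensor_lift _ (fun (vs : p.-tuple V) w => qpure [tuple of v :: vs] w) t.

Lemma upd_cons0 (X : Type) p (v u : X) (vs : p.-tuple X) :
  upd [tuple of v :: vs] ord0 u = [tuple of u :: vs].
Proof.
apply: eq_from_tnth => l; rewrite tnth_mktuple.
by case: (unliftP ord0 l) => [k ->|->]; rewrite ?eqxx ?tnth0 //= !tnthS.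
Qed.

Lemma upd_consS (X : Type) p (v u : X) (vs : p.-tuple X) k :
  upd [tuple of v :: vs] (lift ord0 k) u = [tuple of v :: upd vs k u].
Proof.
apply: eq_from_tnth => l; rewrite tnth_mktuple.
case: (unliftP ord0 l) => [i ->|->]; rewrite ?tnth0 //= !tnthS tnth_mktuple.
by rewrite (inj_eq lift_inj).
Qed.

Lemma qcons_pure p v (vs : p.-tuple V) w :
  qcons v (qpure vs w) = qpure [tuple of v :: vs] w.
Proof.
have [addl addr mid last] := @pure_balanced _ _ W
  (fun (v : V) (a : Q) => a *: v) p.+1.
apply: tensor_liftE; split=> [v0 k u u' w0|v0 w0 w'|v0 k l b w0 lk|v0 k b w0 pk];
  rewrite /qpure.
- by rewrite -!upd_consS; apply: addl.
- exact: addr.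
- rewrite -!upd_consS; have := mid [tuple of v :: v0] (lift ord0 k) (lift ord0 l).
  by rewrite !tnthS; apply; rewrite !lift0 lk.
- rewrite -!upd_consS; have := last [tuple of v :: v0] (lift ord0 k).
  by rewrite !tnthS; apply; rewrite lift0 -pk.
Qed.

Lemma upd_tnth (X : Type) p (v : p.-tuple X) k : upd v k (tnth v k) = v.
Proof.
by apply: eq_from_tnth => l; rewrite tnth_mktuple; case: eqP => // ->.
Qed.

Lemma qpureZ p a (v : p.-tuple V) (w : W) : qpure v (a *: w) = a *: qpure v w.
Proof. exact/esym/qtensor_scale_pure. Qed.

Lemma qpure_updZ p a (v : p.-tuple V) k (w : W) :
  qpure (upd v k (a *: tnth v k)) w = a *: qpure v w.
Proof.
have [addl addr mid last] := @pure_balanced _ _ W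
  (fun (v : V) (a : Q) => a *: v) p.
rewrite -qpureZ; have [m] := ubnP (p - k); elim: m k => // m IHm k.
rewrite ltnS => pkm; have [pk|] := ltnP k.+1 p; last first.
  by move=> pk; apply: last; apply/eqP; rewrite eqn_leq pk ltn_ord.
rewrite -(IHm (Ordinal pk)); first exact: mid.
by apply: leq_trans pkm; rewrite ltn_sub2l.
Qed.

Lemma qcons0 p (v : V) : qcons v (0 : T p) = 0.
Proof. exact: raddf0. Qed.
Lemma qconsB p (v : V) (t t' : T p) : qcons v (t - t') = qcons v t - qcons v t'.
Proof. exact: raddfB. Qed.

Lemma qconsDl p (v v' : V) (t : T p) :
  qcons (v + v') t = qcons v t + qcons v' t.
Proof.
elim/qtensor_ind: t => [|x y ihx ihy|vs w].
- by rewrite !qcons0 addr0.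
- by rewrite !qconsB ihx ihy opprD addrACA.
rewrite !qcons_pure.
have := balanced_addl (@pure_balanced _ _ W (fun (v : V) (a : Q) => a *: v) _)
  [tuple of v :: vs] ord0 v v' w.
by rewrite !upd_cons0.
Qed.

Lemma qconsDr p (v : V) (t t' : T p) : qcons v (t + t') = qcons v t + qcons v t'.
Proof. exact: raddfD. Qed.

Lemma qconsZl p a (v : V) (t : T p) : qcons (a *: v) t = a *: qcons v t.
Proof.
elim/qtensor_ind: t => [|x y ihx ihy|vs w].
- by rewrite !qcons0 scaler0.
- by rewrite !qconsB ihx ihy scalerBr.
rewrite !qcons_pure -(qpure_updZ _ _ ord0) upd_cons0.
by rewrite tnth0.
Qed.

Lemma qconsZr p a (v : V) (t : T p) : qcons v (a *: t) = a *: qcons v t.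
Proof.
elim/qtensor_ind: t => [|x y ihx ihy|vs w].
- by rewrite scaler0 !qcons0 scaler0.
- by rewrite scalerBr !qconsB ihx ihy scalerBr.
by rewrite -qpureZ !qcons_pure qpureZ.
Qed.

Definition coll1 p (v : V) (s : S) (y : bchange f (T p) N) :
    bchange f (T p.+1) N :=
  bchange_lift f (fun t (n : N) => bpure f (qcons v t) (s *: n)) y.

Lemma coll10 p v s : coll1 v s (0 : bchange f (T p) N) = 0.
Proof. exact: raddf0. Qed.
Lemma coll1B p v s (y y' : bchange f (T p) N) :
  coll1 v s (y - y') = coll1 v s y - coll1 v s y'.
Proof. exact: raddfB. Qed.

Lemma coll1_pure p v s (t : T p) n :
  coll1 v s (bpure f t n) = bpure f (qcons v t) (s *: n).
Proof.
apply: bchange_liftE => [t1 t2 k|t1 k k'|a t1 k].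
- by rewrite qconsDr bpureDl.
- by rewrite scalerDr bpureDr.
- by rewrite qconsZr bpureZ !scalerA amap_central.
Qed.

Definition coll p (u : SV) (y : bchange f (T p) N) : bchange f (T p.+1) N :=
  bchange_lift f (fun (v : V) (s : S^o) => coll1 v s y) u.

Lemma coll0l p (y : bchange f (T p) N) : coll 0 y = 0.
Proof. exact: raddf0. Qed.
Lemma collBl p (u u' : SV) (y : bchange f (T p) N) :
  coll (u - u') y = coll u y - coll u' y.
Proof. exact: raddfB. Qed.

Lemma coll_bpure p v (s : S^o) (y : bchange f (T p) N) :
  coll (bpure f v s) y = coll1 v s y.
Proof.
apply: bchange_liftE => [v1 v2 k|v1 k k'|a v1 k]; elim/bchange_ind: y => //.
- by rewrite !coll10 addr0.
- move=> x y ihx ihy; rewrite !coll1B ihx ihy.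
  by rewrite opprD addrACA.
- by move=> t n; rewrite !coll1_pure qconsDl bpureDl.
- by rewrite !coll10 addr0.
- move=> x y ihx ihy; rewrite !coll1B ihx ihy.
  by rewrite opprD addrACA.
- by move=> t n; rewrite !coll1_pure scalerDl bpureDr.
- by rewrite !coll10.
- by move=> x y ihx ihy; rewrite !coll1B ihx ihy.
- by move=> t n; rewrite !coll1_pure qconsZl bpureZ scalerA.
Qed.

Lemma collDl p (u u' : SV) (y : bchange f (T p) N) :
  coll (u + u') y = coll u y + coll u' y.
Proof. exact: raddfD. Qed.

Lemma collBr p (u : SV) (y y' : bchange f (T p) N) :
  coll u (y - y') = coll u y - coll u y'.
Proof.
elim/bchange_ind: u => [|u u' ihu ihu'|v s].
- by rewrite !coll0l subr0.
- by rewrite !collBl ihu ihu' !opprD !opprK addrACA.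
- by rewrite !coll_bpure coll1B.
Qed.

Lemma coll0r p (u : SV) : coll u (0 : bchange f (T p) N) = 0.
Proof. by have := collBr u (0 : bchange f (T p) N) 0; rewrite !subrr. Qed.

Lemma collDr p (u : SV) (y y' : bchange f (T p) N) :
  coll u (y + y') = coll u y + coll u y'.
Proof. by apply/(canRL (subrK _)); rewrite -collBr addrK. Qed.

Lemma bchange_rmul_pure (v : V) (s t : S) :
  bchange_rmul (bpure f v (s : S^o)) t = bpure f v (s * t : S^o).
Proof.
apply: bchange_liftE => [v1 v2 k|v1 k k'|a v1 k].
- exact: bpureDl.
- by rewrite mulrDl bpureDr.
- by rewrite bpureZ; congr bpure; rewrite /GRing.scale /= mulrA.
Qed.

Lemma rmul0 s : bchange_rmul (0 : SV) s = 0.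
Proof. exact: raddf0. Qed.
Lemma rmulB (u u' : SV) s :
  bchange_rmul (u - u') s = bchange_rmul u s - bchange_rmul u' s.
Proof. exact: raddfB. Qed.

Lemma coll_balanced p (u : SV) s (y : bchange f (T p) N) :
  coll (bchange_rmul u s) y = coll u (s *: y).
Proof.
elim/bchange_ind: u => [|u u' ihu ihu'|v t].
- by rewrite rmul0 !coll0l.
- by rewrite rmulB !collBl ihu ihu'.
rewrite bchange_rmul_pure !coll_bpure.
elim/bchange_ind: y => [|x y ihx ihy|q n].
- by rewrite scaler0 !coll10.
- by rewrite scalerBr !coll1B ihx ihy.
- by rewrite bpureZr !coll1_pure scalerA.
Qed.

Lemma collZ p (u : SV) s (y : bchange f (T p) N) :
  coll (s *: u) y = s *: coll u y.
Proof.
elim/bchange_ind: u => [|u u' ihu ihu'|v t].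
- by rewrite scaler0 !coll0l scaler0.
- by rewrite scalerBr !collBl ihu ihu' scalerBr.
rewrite bpureZr !coll_bpure.
elim/bchange_ind: y => [|x y ihx ihy|q n].
- by rewrite !coll10 scaler0.
- by rewrite !coll1B ihx ihy scalerBr.
- by rewrite !coll1_pure bpureZr scalerA.
Qed.

Definition coll0 (y : bchange f W N) : bchange f (T 0) N :=
  bchange_lift f (fun w (n : N) => bpure f (qpure [tuple] w) n) y.

Lemma coll00 : coll0 0 = 0.
Proof. exact: raddf0. Qed.
Lemma coll0B y y' : coll0 (y - y') = coll0 y - coll0 y'.
Proof. exact: raddfB. Qed.

Lemma coll0_pure w n : coll0 (bpure f w n) = bpure f (qpure [tuple] w) n.
Proof.
apply: bchange_liftE => [t1 t2 k|t1 k k'|a t1 k].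
- by rewrite qpureD bpureDl.
- by rewrite bpureDr.
- by rewrite qpureZ bpureZ.
Qed.

Lemma coll0Z s y : coll0 (s *: y) = s *: coll0 y.
Proof.
elim/bchange_ind: y => [|x y ihx ihy|q n].
- by rewrite scaler0 !coll00 scaler0.
- by rewrite scalerBr !coll0B ihx ihy scalerBr.
- by rewrite bpureZr !coll0_pure bpureZr.
Qed.

Fixpoint collapse p : p.-tuple SV -> bchange f W N -> bchange f (T p) N :=
  if p is p'.+1 return p.-tuple SV -> bchange f W N -> bchange f (T p) N
  then fun v w => coll (thead v) (collapse [tuple of behead v] w)
  else fun _ w => coll0 w.

Lemma collapse_cons p u (v : p.-tuple SV) w :
  collapse [tuple of u :: v] w = coll u (collapse v w).
Proof. by rewrite /= theadE; congr (coll _ (collapse _ _)); apply/val_inj. Qed.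

Lemma collapse_balanced p :
  balanced (W := bchange f W N) (@bchange_rmul Q S f V) (@collapse p).
Proof.
have lead q (u : SV) (s : S) (v : q.-tuple SV) w :
    collapse [tuple of s *: u :: v] w = s *: collapse [tuple of u :: v] w.
  by rewrite !collapse_cons collZ.
elim: p => [|p [addl addr mid last]]; split.
- by move=> v [].
- by move=> v w w'; rewrite /= /coll0 raddfD.
- by move=> v [].
- by move=> v [].
- move=> v k u u' w; case/tupleP: v => x v.
  case: (unliftP ord0 k) => [i ->|->].
    by rewrite !upd_consS !collapse_cons addl collDr.
  by rewrite !upd_cons0 !collapse_cons collDl.
- move=> v w w'; case/tupleP: v => x v.
  by rewrite !collapse_cons addr collDr.
- move=> v k l a w; case/tupleP: v => x v.
  case: (unliftP ord0 l) => [j ->|->] //.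
  case: (unliftP ord0 k) => [i ->|->]; rewrite ?lift0 !tnthS.
    by move=> [lk]; rewrite !upd_consS !collapse_cons (mid v i j a w lk).
  move=> [lk]; rewrite upd_cons0 upd_consS !collapse_cons tnth0 coll_balanced.
  congr coll; move=> {k l}; case: p j v addl addr mid last lk => [|p] j v _ _ _ _ lk.
    by case: j lk.
  case/tupleP: v => y v; have -> : j = ord0 by apply/val_inj.
  by rewrite upd_cons0 tnth0 lead.
- move=> v k a w; case/tupleP: v => x v.
  case: (unliftP ord0 k) => [i ->|->]; rewrite ?lift0 ?tnthS ?tnth0.
    by move=> [lk]; rewrite !upd_consS !collapse_cons (last v i a w lk).
  move=> [p0]; move: v addl addr mid last => {k}; rewrite p0 => v _ _ _ _.
  by rewrite upd_cons0 !collapse_cons coll_balanced /= coll0Z.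
Qed.

Lemma collapse_pure p (v : p.-tuple V) (s : p.-tuple S) w n :
  collapse [tuple bpure f (tnth v k) (tnth s k : S^o) | k < p] (bpure f w n) =
  bpure f (qpure v w) ((\prod_(k < p) tnth s k) *: n).
Proof.
elim: p v s => [|p IHp] v s.
  by rewrite big_ord0 scale1r /= coll0_pure (tuple0 v).
case/tupleP: v => x v; case/tupleP: s => y s.
have -> : [tuple bpure f (tnth [tuple of x :: v] k)
             (tnth [tuple of y :: s] k : S^o) | k < p.+1] =
          [tuple of bpure f x (y : S^o) ::
             [tuple bpure f (tnth v k) (tnth s k : S^o) | k < p]].
  apply: eq_from_tnth => k; rewrite tnth_mktuple.
  by case: (unliftP ord0 k) => [i ->|->]; rewrite ?tnth0 ?tnthS ?tnth_mktuple.
rewrite collapse_cons IHp coll_bpure coll1_pure qcons_pure scalerA.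
rewrite big_ord_recl tnth0; congr (bpure f _ ((_ * _) *: _)).
by apply: eq_bigr => k _; rewrite tnthS.
Qed.

Lemma extends_scalars_exists p (phi : {linear qtensor V W p -> W}) :
  exists g : {additive stensor f V W N p -> bchange f W N},
    extends_scalars (f := f) (N := N) phi g.
Proof.
pose phiN : bchange f (T p) N -> bchange f W N :=
  bchange_lift f (fun t (n : N) => bpure f (phi t) n).
have phiN_pure t n : phiN (bpure f t n) = bpure f (phi t) n.
  apply: bchange_liftE => [t1 t2 k|t1 k k'|a t1 k].
  - by rewrite raddfD bpureDl.
  - by rewrite bpureDr.
  - by rewrite linearZ bpureZ.
pose g0 (x : stensor f V W N p) : bchange f W N :=
  phiN (tensor_lift _ (@collapse p) x).
have g0B : zmod_morphism g0 by move=> x y; rewrite /g0 /phiN !raddfB.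
pose g : {additive stensor f V W N p -> bchange f W N} :=
  HB.pack g0 (GRing.isZmodMorphism.Build _ _ _ g0B).
exists g => v s w n; rewrite /= /g0 tensor_liftE; last exact: collapse_balanced.
by rewrite collapse_pure phiN_pure.
Qed.

Lemma extends_scalars_unique p (phi : qtensor V W p -> W)
    (g h : {additive stensor f V W N p -> bchange f W N}) :
  extends_scalars (f := f) (N := N) phi g ->
  extends_scalars (f := f) (N := N) phi h -> g =1 h.
Proof.
move=> gE hE; apply: tensor_ext.
pose simple (u : SV) := exists a : V * S, u = bpure f a.1 (a.2 : S^o).
suff gh m (v : p.-tuple SV) w : (forall k : 'I_p, m <= k -> simple (tnth v k))%N ->
    g (spure v w) = h (spure v w).
  by move=> v w; apply: (gh p) => k; rewrite leqNgt ltn_ord.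
elim: m v w => [|m IHm] v w vS.
  have /choice [F FE] : forall k, simple (tnth v k) by move=> k; apply: vS.
  have -> : v = [tuple bpure f (tnth [tuple (F k).1 | k < p] k)
                   (tnth [tuple (F k).2 | k < p] k : S^o) | k < p].
    by apply: eq_from_tnth => k; rewrite !tnth_mktuple FE.
  have addr v0 (w0 w' : bchange f W N) :
    spure v0 (w0 + w') = spure v0 w0 + spure v0 w'.
    exact: balanced_addr (pure_balanced _ _ _) v0 w0 w'.
  elim/bchange_ind: w => [|x y ihx ihy|w n]; last by rewrite gE hE.
    have addr0 v0 : spure v0 (0 : bchange f W N) = 0.
      by apply: (@addrI _ (spure v0 0)); rewrite addr0 -addr addr0.
    by rewrite !addr0 !raddf0.
  have addrB v0 : spure v0 (x - y) = spure v0 x - spure v0 y.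
    by apply/(canRL (addrK _)); rewrite -addr subrK.
  by rewrite !addrB !raddfB ihx ihy.
have [pm|mp] := leqP p m.
  by apply: IHm => k mk; have := leq_ltn_trans (leq_trans pm mk) (ltn_ord k); rewrite ltnn.
pose k := Ordinal mp; rewrite -(upd_tnth v k).
have addl v0 k0 u u' (w0 : bchange f W N) : spure (upd v0 k0 (u + u')) w0 =
    spure (upd v0 k0 u) w0 + spure (upd v0 k0 u') w0.
  exact: balanced_addl (pure_balanced _ _ _) v0 k0 u u' w0.
elim/bchange_ind: (tnth v k) => [|x y ihx ihy|a s].
- have -> : spure (upd v k 0) w = 0.
    by apply: (@addrI _ (spure (upd v k 0) w)); rewrite addr0 -addl addr0.
  by rewrite !raddf0.
- have -> : spure (upd v k (x - y)) w = spure (upd v k x) w - spure (upd v k y) w.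
    by apply/(canRL (addrK _)); rewrite -addl subrK.
  by rewrite !raddfB ihx ihy.
apply: IHm => l ml; rewrite tnth_mktuple; case: eqP => [_|/eqP lk].
  by exists (a, s : S).
by apply: vS; rewrite ltn_neqAle ml andbT; apply: contra_neq lk => ml'; apply/val_inj.
Qed.
End ExtensionExists.

(** [phi (x) N] (for [W = V], [N = S]: [phi (x) S]) *)
Definition base_change (Q : comPzRingType) (S : pzRingType)
    (f : algebra_map Q S) (V W : lmodType Q) (N : lmodType S) p
    (phi : {linear qtensor V W p -> W}) :
    {additive stensor f V W N p -> bchange f W N} :=
  sval (cid (extends_scalars_exists f N phi)).

Section BarOperators.
Variables (K : pzRingType) (U W : lmodType K) (ra : U -> K -> U).
Local Notation BU := (tensor U ra).
Local Notation BW := (tensor W ra).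

(** [sgn u = (-1)^|u| u]; [mU i] and [mW i] have [i] arguments and are used
    for [i >= 1] only. *)
Variables (sgn : U -> U) (mU : forall i, BU i.-1 -> U) (mW : forall i, BW i.-1 -> W).

(** [1^j (x) m_i (x) 1^(p-i-j+1)] on [U^p (x) W], for [i + j <= p + 1]; as
    [m_i] has odd degree it acquires the sign of the first [j] entries. The last
    entry is in [W], so that [m_i] is [mW i] when [j = p - i + 1]. The function
    being lifted is [balanced] when [i >= 1], [sgn] is linear for both actions
    and [mU i], [mW i] are linear for the outer actions. *)
Definition bar_insert (p i j : nat) : {additive BW p -> BW (p.+1 - i)} :=
  tensor_lift ra (fun v w =>
    if j == (p.+1 - i)%N then
      pure ra [tuple sgn (nth 0 v k) | k < p.+1 - i]
        (mW (pure ra [tuple nth 0 v (j + k)%N | k < i.-1] w))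
    else
      pure ra [tuple if (k < j)%N then sgn (nth 0 v k)
                     else if k == j :> nat then
                       mU (pure ra [tuple nth 0 v (j + l)%N | l < i.-1]
                             (nth 0 v (j + i.-1)%N))
                     else nth 0 v (k + i.-1)%N | k < p.+1 - i] w).

Definition bar_term i p (x : BW p) : BW (p.+1 - i) :=
  \sum_(0 <= j < (p.+1 - i).+1) bar_insert p i j x.

Fact bar_term_additive i p : zmod_morphism (@bar_term i p).
Proof.
by move=> x y; rewrite /bar_term -sumrB; apply: eq_bigr => j _; rewrite raddfB.
Qed.
HB.instance Definition _ i p :=
  GRing.isZmodMorphism.Build (BW p) (BW (p.+1 - i)) (@bar_term i p)
    (@bar_term_additive i p).

End BarOperators.

Definition projective (K : pzRingType) (P : lmodType K) : Prop :=
  forall (X Y : lmodType K) (g : {linear X -> Y}) (h : {linear P -> Y}),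
    (forall y, exists x, g x = y) -> exists k : {linear P -> X}, g \o k =1 h.

Record projective_resolution (K : pzRingType) (C : nat -> lmodType K)
    (d : forall n, {linear C n.+1 -> C n}) (M : zmodType) (eps : C 0%N -> M) :
    Prop := ProjectiveResolution {
  resolution_projective : forall n, projective (C n);
  resolution_surj : forall u, exists x, eps x = u;
  resolution_exact0 : forall x, eps x = 0 <-> exists y, d 0%N y = x;
  resolution_exact : forall n x, d n x = 0 <-> exists y, d n.+1 y = x }.

(** [pi] exhibits [R] as [Q / I] *)
Definition quotient_by (Q R : comPzRingType) (I : set Q)
    (pi : {rmorphism Q -> R}) : Prop :=
  (forall r, exists a, pi a = r) /\ (forall a, I a <-> pi a = 0).

(** The graded module [A] with [A_0 = Q] and [A_(n+1) = Ap n]. *)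
Definition with_unit (Q : comPzRingType) (Ap : nat -> lmodType Q) (n : nat) :
  lmodType Q := if n is n'.+1 then Ap n' else Q^o.

Section AInfinity.
Variables (Q : comPzRingType) (Ap : nat -> lmodType Q).
Variable dA : forall n, {linear with_unit Ap n.+1 -> with_unit Ap n}.

(** [A_+[1]]: the summand [Ap n = A_(n+1)] sits in degree [n + 2]. *)
Local Notation V := (gtotal Ap).

(** [m i] is the [i]-ary operation [A_+[1]^i -> A_+[1]]; [m 0] is not used. *)
Definition algebra_operations : Type :=
  forall i, {linear qtensor V V i.-1 -> V}.

Definition d1A (v : V) : Q := dA 0%N (v 0%N).

Section Operations.
Variables (m : algebra_operations) (W : nat -> lmodType Q).

(** [mW i] is the [i]-ary operation [A_+[1]^(i-1) (x) W -> W]. *)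
Definition module_operations : Type :=
  forall i, {linear qtensor V (gtotal W) i.-1 -> gtotal W}.

Variable mW : module_operations.

(** all [mW i], [i >= 1], have degree [-1], where [W n] sits in degree [n + s] *)
Definition operations_degree (s : nat) : Prop :=
  forall i (v : i.-1.-tuple V) (w : gtotal W) (e : i.-1.-tuple int) (e' : int),
    (0 < i)%N -> (forall k, homogeneous 2 (tnth e k) (tnth v k)) ->
    homogeneous s e' w ->
    homogeneous s (\sum_(k < i.-1) tnth e k + e' - 1) (mW i (qpure v w)).

(** [\sum_i \sum_j m_(n-i+1) (1^j (x) m_i (x) 1^(n-i-j))] for [n = p + 1] *)
Definition stasheff (p : nat) (x : qtensor V (gtotal W) p) : gtotal W :=
  \sum_(1 <= i < p.+2) mW (p.+1 - i).+1
    (bar_term (koszul 2) (fun i => m i) (fun i => mW i) i x).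

End Operations.

Record a_infinity_algebra (m : algebra_operations) : Prop := AInfinityAlgebra {
  algebra_degree : operations_degree m 2;
  (* the differential of the shift [A_+[1]] is [- d^A] *)
  algebra_m1 : forall (v : V) (n : nat), m 1%N (qpure [tuple] v) n = - dA n.+1 (v n.+1);
  algebra_m2 : forall v w : V,
    stasheff m m (qpure [tuple v] w) = d1A v *: w - d1A w *: v;
  algebra_m3 : forall n (x : qtensor V V n.-1), (3 <= n)%N -> stasheff m m x = 0 }.

Variable G : nat -> lmodType Q.
Variable dG : forall n, {linear G n.+1 -> G n}.

Record a_infinity_module (m : algebra_operations) (mG : module_operations G) :
    Prop := AInfinityModule {
  module_degree : operations_degree mG 0;
  module_m1 : forall (g : gtotal G) (n : nat), mG 1%N (qpure [tuple] g) n = dG n (g n.+1);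
  module_m2 : forall (v : V) (g : gtotal G),
    stasheff m mG (qpure [tuple v] g) = d1A v *: g;
  module_m3 : forall n (x : qtensor V (gtotal G) n.-1), (3 <= n)%N ->
    stasheff m mG x = 0 }.

End AInfinity.

Section BarFiltration.
Variables (E0 : nat -> zmodType) (d : {additive dsum E0 -> dsum E0}).
Local Notation X := (dsum E0).

(** [F_p X] is the sum of the [E0 l] with [l <= p]. *)
Definition filtration (p : int) (y : X) : Prop :=
  forall l : nat, p < l%:Z -> y l = 0.

Definition cycles (r p : int) (y : X) : Prop :=
  filtration p y /\ filtration (p - r) (d y).

Definition boundaries (r p : int) (y : X) : Prop :=
  exists2 z, cycles r (p + r) z & d z = y.

Definition in_cycles (r p : int) : {pred X} := fun y => `[< cycles r p y >].

Fact in_cycles_zmod_closed r p : zmod_closed (in_cycles r p).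
Proof.
split; first by apply/asboolP; split=> l _; rewrite ?raddf0.
move=> y z /asboolP[yF ydF] /asboolP[zF zdF]; apply/asboolP; split=> l pl.
  by rewrite dsumBE yF ?zF ?subr0.
by rewrite raddfB dsumBE ydF ?zdF ?subr0.
Qed.
HB.instance Definition _ r p :=
  GRing.isZmodClosed.Build X (in_cycles r p) (in_cycles_zmod_closed r p).

Record zcycles (r p : int) := Zcycles { zval :> X; _ : zval \in in_cycles r p }.
HB.instance Definition _ r p := [isSub for @zval r p].
HB.instance Definition _ r p := [Choice of zcycles r p by <:].
HB.instance Definition _ r p := [SubChoice_isSubZmodule of zcycles r p by <:].

(** [E^r_p = Z^r_p / (Z^(r-1)_(p-1) + B^(r-1)_p)] *)
Definition page (r p : int) : zmodType :=
  zquot [set y : zcycles r p | exists a b : X,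
    [/\ cycles (r - 1) (p - 1) a, boundaries (r - 1) p b & zval y = a + b]].

Definition page_class (r p : int) (y : X) : page r p :=
  zproj _ (insubd (0 : zcycles r p) y).

(** [d^r : E^r_p -> E^r_(p-r)], induced by [d]; the default value of
    [page_class] plays no role as [d] maps [Z^r_p] to [Z^r_(p-r)] if [d^2 = 0]. *)
Definition page_diff (r p : int) (e : page r p) : page r (p - r) :=
  page_class r (p - r) (d (zval (zrepr e))).

Definition component (p : int) (y : X) : X :=
  if p is Posz l then dsum_inj l (y l) else 0.

(** [x] is the image in [X] of an element of [E0 p], zero if [p < 0]. *)
Definition survives (r p : int) (x : X) : Prop :=
  exists2 y, cycles r p y & component p y = x.

(** The image in [E^r_p] of an [x] in [E0 p] surviving to [E^r_p]; it does not
    depend on the chosen [y]. *)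
Definition survivor_class (r p : int) (x : X) : page r p :=
  if pselect (survives r p x) is left xr then page_class r p (s2val (cid2 xr))
  else 0.

End BarFiltration.

Section Avramov.
Variables (Q : comPzRingType) (S : pzRingType) (f : algebra_map Q S).
Variables (N : lmodType S) (Ap G : nat -> lmodType Q).
Local Notation V := (gtotal Ap).
Local Notation SV := (bchange f V S^o).

Variables (m : algebra_operations Ap) (mG : module_operations Ap G).

(** [E^0_p = (A_+[1] (x) S)^p (x)_S (G (x) N)] *)
Definition bar_page (p : nat) : zmodType := stensor f V (gtotal G) N p.

Definition bar_complex : zmodType := dsum bar_page.

Definition koszul_bar (x : SV) : SV :=
  bchange_lift f (fun (v : V) (s : S^o) => bpure f (koszul 2 v) s) x.

Definition mbar i := base_change f S^o (m i).
Definition mGbar i := base_change f N (mG i).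

(** [1^j (x) mbar_i (x) 1^(p-i-j+1) : E^0_p -> E^0_(p-i+1)], as a map on the sum
    [X] of the [E^0_p]; it vanishes on the [E^0_p] with [p + 1 < i + j]. *)
Definition bar_op (i j : nat) : bar_complex -> bar_complex :=
  dsum_lift (fun p (x : bar_page p) =>
    if (i + j <= p.+1)%N then
      dsum_inj (p.+1 - i)%N (bar_insert koszul_bar mbar mGbar p i j x : bar_page _)
    else 0).

(** [t_i : E^0_p -> E^0_(p-i+1)], as a map on [X] *)
Definition bar_t (i : nat) : bar_complex -> bar_complex :=
  dsum_lift (fun p (x : bar_page p) =>
    if (i <= p.+1)%N then
      dsum_inj (p.+1 - i)%N (bar_term koszul_bar mbar mGbar i x : bar_page _)
    else 0).

(** [d = t_1 + ... + t_(p+1)] on [E^0_p] *)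
Definition bar_d_fun : bar_complex -> bar_complex :=
  dsum_lift (fun p (x : bar_page p) =>
    \sum_(1 <= i < p.+2)
      dsum_inj (p.+1 - i)%N (bar_term koszul_bar mbar mGbar i x : bar_page _)).

Fact bar_d_additive : zmod_morphism bar_d_fun.
Proof.
apply: dsum_lift_additive => p x y; rewrite -sumrB; apply: eq_bigr => i _.
by rewrite !raddfB.
Qed.

Definition bar_d : {additive bar_complex -> bar_complex} :=
  HB.pack bar_d_fun (GRing.isZmodMorphism.Build _ _ _ bar_d_additive).

(** a family [x_l] of elements of the [E^0_l], indexed by all integers and with
    values in [X]; [x_l = 0] for [l < 0] *)
Definition extend (x : forall l, bar_page l) (l : int) : bar_complex :=
  if l is Posz k then dsum_inj k (x k) else 0.

End Avramov.

Arguments bar_op {Q S} f N {Ap G} m mG i j y : rename.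
Arguments bar_t {Q S} f N {Ap G} m mG i y : rename.
Arguments bar_d {Q S} f N {Ap G} m mG : rename.

(* Main.v *)
Require Import Defs.
From HB Require Import structures.
From mathcomp Require Import all_boot all_order all_algebra.
From mathcomp Require Import boolp classical_sets zify.

Set Implicit Arguments.
Unset Strict Implicit.
Unset Printing Implicit Defensive.

(** The element [x] survives to [E^r] when it is the leading term of some [y] in
    [F_p X] with [d y] in [F_(p-r) X]. As [t_i] lowers the number of bars by
    [i - 1], the component of [d y] in [E^0_(p-n)] involves the components of
    [y] with at least [p - n] bars only. The vanishing of these for [n < r] is the
    system of equations, and the component for [n = r] represents [d^r x].

    This also needs [d (d y) = 0]. A tensor [v_1 (x) ... (x) v_p (x) w] is treated
    as a word, on which [d] acts by applying an operation to a block of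
    consecutive letters. In [d (d y)] the terms from disjoint blocks cancel by
    the Koszul sign, and those from nested blocks add up to Stasheff expressions;
    the latter vanish over [S], because [d_1^A] has its image in the kernel of
    [Q -> S]. *)

Import Order.TTheory GRing.Theory Num.Theory.
Local Open Scope ring_scope.

(** * Words and block operations *)

Section SplitSum.
Variables (L : Type) (Z : zmodType).
Implicit Types (s : seq L) (F : seq L -> seq L -> Z).

(** Summation over the deconcatenation coproduct of a word. The recursion suits the inductions
    below; [split_sum_nat] recovers the sum over cut positions. *)
Fixpoint split_sum F s : Z :=
  F [::] s + if s is x :: s' then split_sum (fun b c => F (x :: b) c) s' else 0.

Lemma eq_split_sum F F' s :
  (forall b c, s = b ++ c -> F b c = F' b c) -> split_sum F s = split_sum F' s.
Proof.
elim: s F F' => [|x s IHs] F F' FF' /=; first by rewrite FF'.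
rewrite FF' //; congr (_ + _); apply: IHs => b c sbc.
by apply: FF'; rewrite sbc.
Qed.

Lemma split_sumD F F' s :
  split_sum (fun b c => F b c + F' b c) s = split_sum F s + split_sum F' s.
Proof.
elim: s F F' => [|x s IHs] F F' /=; first by rewrite !addr0.
by rewrite IHs addrACA.
Qed.

Lemma split_sum0 s : split_sum (fun _ _ => 0) s = 0.
Proof. by elim: s => [|x s IHs] /=; rewrite ?IHs addr0. Qed.

Lemma split_sum_nat F s :
  split_sum F s = \sum_(0 <= i < (size s).+1) F (take i s) (drop i s).
Proof.
elim: s F => [|x s IHs] F /=; first by rewrite big_nat1 addr0.
by rewrite big_nat_recl // IHs.
Qed.

(** Coassociativity of deconcatenation: both sides run over the ways to cut [s] into three words. *)
Lemma split_sum_coassoc (F : seq L -> seq L -> seq L -> Z) s :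
  split_sum (fun b c => split_sum (F b) c) s =
  split_sum (fun b c => split_sum (fun b1 b2 => F b1 b2 c) b) s.
Proof.
elim: s F => [|x s IHs] F //=.
by rewrite (IHs (fun b => F (x :: b))) split_sumD addr0 !addrA.
Qed.

End SplitSum.

Lemma raddf_split_sum (L : Type) (Z Z' : zmodType) (g : {additive Z -> Z'})
    (F : seq L -> seq L -> Z) s :
  g (split_sum F s) = split_sum (fun b c => g (F b c)) s.
Proof.
elim: s F => [|x s IHs] F /=; first by rewrite !addr0.
by rewrite raddfD IHs.
Qed.

Section WordDifferential.
Variables (L : Type) (sgn : L -> L) (m : seq L -> L).

Definition head_sum (Z : zmodType) (F : seq L -> Z) s : Z :=
  if s is x :: s' then split_sum (fun b c => F (m (x :: b) :: c)) s' else 0.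

(** The bar differential in continuation form: words have no formal sums, so each word produced is
    passed to [F] and the values are added in [Z]. Letters before the block take the sign [sgn]. *)
Fixpoint wdiff (Z : zmodType) (F : seq L -> Z) s : Z :=
  head_sum F s +
  if s is x :: s' then wdiff (fun y => F (sgn x :: y)) s' else 0.

Definition block_op (Z : Type) (F : seq L -> Z) i j s : Z :=
  F (map sgn (take j s) ++ m (take i (drop j s)) :: drop i (drop j s)).

(** Every word produced contains the output letter of an operation, so [F] is evaluated at nonempty
    words only. *)
Lemma eq_wdiff (Z : zmodType) (F F' : seq L -> Z) s :
  (forall x y, F (x :: y) = F' (x :: y)) -> wdiff F s = wdiff F' s.
Proof.
elim: s F F' => [|x s IHs] F F' FF' //=.
by rewrite (@IHs _ (fun y => F' (sgn x :: y))) //; under eq_split_sum do rewrite FF'.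
Qed.

Lemma wdiffD (Z : zmodType) (F F' : seq L -> Z) s :
  wdiff (fun y => F y + F' y) s = wdiff F s + wdiff F' s.
Proof.
elim: s F F' => [|x s IHs] F F' /=; first by rewrite !addr0.
by rewrite split_sumD IHs addrACA.
Qed.

Lemma wdiff_cons0 (Z : zmodType) (F : seq L -> Z) s :
  (forall x y, F (x :: y) = 0) -> wdiff F s = 0.
Proof.
move=> F0; rewrite (@eq_wdiff _ F (fun=> 0)) //.
elim: s {F F0} => [|x s IHs] /=; first by rewrite addr0.
by rewrite split_sum0 IHs addr0.
Qed.

Lemma raddf_wdiff (Z Z' : zmodType) (g : {additive Z -> Z'}) (F : seq L -> Z) s :
  g (wdiff F s) = wdiff (fun y => g (F y)) s.
Proof.
elim: s F => [|x s IHs] F /=; first by rewrite !addr0 raddf0.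
by rewrite raddfD raddf_split_sum IHs.
Qed.

Lemma wdiff_nat (Z : zmodType) (F : seq L -> Z) s :
  wdiff F s = \sum_(1 <= i < (size s).+1)
                \sum_(0 <= j < (size s - i).+1) block_op F i j s.
Proof.
elim: s F => [|x s IHs] F /=; first by rewrite big_geq ?addr0.
rewrite IHs split_sum_nat big_add1 /=.
under [RHS]eq_big_nat => i /andP[_ i_lt].
  rewrite subSS big_nat_recl //= {1}/block_op /=.
  over.
rewrite big_split /=; congr (_ + _).
rewrite [RHS]big_nat_recr //= subnn [X in _ = _ + X]big_geq // addr0.
by rewrite big_add1; apply: eq_big_nat => i /andP[_ i_lt]; rewrite subnSK.
Qed.

(** The coderivation property: the output letter of the operation lies to the left or to the right
    of the cut, and in the second case the whole left part has been passed and takes signs. *)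
Lemma wdiff_split_sum (Z : zmodType) (F : seq L -> seq L -> Z) s :
  wdiff (split_sum F) s =
    split_sum (fun b c => wdiff (F^~ c) b) s +
    split_sum (fun b c => wdiff (F (map sgn b)) c) s.
Proof.
elim: s F => [|x s IHs] F /=; first by rewrite !addr0.
rewrite split_sumD wdiffD IHs split_sumD.
rewrite (split_sum_coassoc (fun b b' c' => F (m (x :: b) :: b') c')) add0r.
set A := split_sum _ _; set B := split_sum _ _; set C := wdiff _ _.
set D := split_sum _ _; set E := split_sum _ _.
rewrite !add0r -!addrA addrCA; congr (_ + _).
by rewrite [C + _]addrCA addrCA.
Qed.

End WordDifferential.

Definition multiadditive (L Z : zmodType) (F : seq L -> Z) : Prop :=
  forall a c, zmod_morphism (fun x => F (a ++ x :: c)).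

(* The terms of the square in which one operation is fed into another one make
   up the Stasheff expressions [wdiff sgn m m]; the other terms cancel in pairs. *)
Lemma wdiff_wdiff (L Z : zmodType) (sgn : L -> L) (m : seq L -> L)
    (F : seq L -> Z) s :
  involutive sgn -> multiadditive F ->
  (forall a x b c, F (a ++ wdiff sgn m m (x :: b) :: c) = 0) ->
  (forall a x b y c, F (a ++ sgn (m (x :: b)) :: y :: c) +
                     F (a ++ m (map sgn (x :: b)) :: y :: c) = 0) ->
  wdiff sgn m (wdiff sgn m F) s = 0.
Proof.
move=> sgnK; elim: s F => [|x s IHs] F Fadd Fst Fsgn; first by rewrite /= addr0.
rewrite [LHS]/= wdiffD.
(* Neither operation touches the first letter here. It takes two signs, which cancel, and the
   induction hypothesis applies to [F (x :: _)]. *)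
rewrite [X in _ + (_ + X)](_ : _ = 0) ?addr0; last first.
  rewrite -[RHS](IHs (fun y => F (x :: y))).
  - by apply: eq_wdiff => y z; rewrite sgnK.
  - by move=> a c; apply: (Fadd (x :: a)).
  - by move=> a; apply: (Fst (x :: a)).
  - by move=> a; apply: (Fsgn (x :: a)).
rewrite wdiff_split_sum /= split_sumD -!addrA.
rewrite [X in _ + X = _]addrC -addrA [X in _ + (_ + X) = _]addrC.
rewrite -[X in _ + (_ + X) = _]split_sumD.
(* Disjoint blocks, one of them starting at the first letter: the two orders of application cancel
   by [Fsgn]. *)
rewrite [X in _ + (_ + X) = _](_ : _ = 0) ?addr0; last first.
  rewrite -[RHS](split_sum0 Z s); apply: eq_split_sum => b c _.
  rewrite -wdiffD; apply: wdiff_cons0 => y z.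
  exact: (Fsgn [::]).
(* Nested blocks remain. Regrouped by the outer block [x :: b], they sum to [F] at the Stasheff
   expression of that block. *)
rewrite (split_sum_coassoc (fun b b' c => F (m (m (x :: b) :: b') :: c))).
rewrite -split_sumD -[RHS](split_sum0 Z s).
apply: eq_split_sum => b c _.
pose g : {additive L -> Z} :=
  HB.pack (fun z => F (z :: c)) (GRing.isZmodMorphism.Build _ _ _ (Fadd [::] c)).
have := Fst [::] x b c; rewrite /= -[F _]/(g _) raddfD.
by rewrite raddf_split_sum raddf_wdiff.
Qed.

(** * Tensors as words *)

Lemma val_upd p (T : Type) (v : p.-tuple T) k u :
  val (upd v k u) = take k v ++ u :: drop k.+1 v.
Proof.
have pk := ltn_ord k; apply: (@eq_from_nth _ u) => [|i].
  by rewrite size_tuple size_cat size_take /= size_drop size_tuple pk -addSnnS subnKC.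
rewrite size_tuple => ip; rewrite -(tnth_nth u _ (Ordinal ip)) tnth_mktuple.
rewrite -val_eqE nth_cat size_take size_tuple pk /=.
case: ltngtP => [ik|ki|->]; last by rewrite subnn.
  by rewrite nth_take // (tnth_nth u).
by rewrite -subnSK //= nth_drop subnKC // (tnth_nth u).
Qed.

Section TensorWords.
Variables (K : pzRingType) (U W : lmodType K) (ra : U -> K -> U).
Local Notation BW := (tensor W ra).
Local Notation L := (U * W)%type.

(** Taking the number of factors from the sequence allows words to be cut and concatenated without
    casts between tuple types. *)
Definition tensor_seq (Z : Type) (g : forall p, BW p -> Z) (s : seq U) (w : W) : Z :=
  g (size s) (pure ra (in_tuple s) w).

Lemma tensor_seqE (Z : Type) (g : forall p, BW p -> Z) p (v : p.-tuple U) w :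
  tensor_seq g v w = g p (pure ra v w).
Proof.
case: v => s sp; rewrite /tensor_seq /=; have /eqP ps := sp; subst p.
by congr (g _ (pure _ _ _)); apply: val_inj.
Qed.

(* A word [x_0 ... x_p] in [U * W] stands for the tensor of the first components
   of [x_0, ..., x_(p-1)] with the second component of [x_p]. *)
Definition word_fun (Z : zmodType) (F : seq U -> W -> Z) (z : seq L) : Z :=
  if z is x :: s then F (map fst (belast x s)) (last x s).2 else 0.

Lemma word_fun_rcons (Z : zmodType) (F : seq U -> W -> Z) s l :
  word_fun F (rcons s l) = F (map fst s) l.2.
Proof. by case: s => [|x s] //=; rewrite belast_rcons last_rcons. Qed.

(** A letter followed by [y] is not the last one, so its second component is never read. *)
Lemma eq_word_fun_fst (Z : zmodType) (F : seq U -> W -> Z) a (x x' y : L) c :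
  x.1 = x'.1 -> word_fun F (a ++ x :: y :: c) = word_fun F (a ++ x' :: y :: c).
Proof.
by move=> xx'; rewrite [y :: c]lastI -!rcons_cons -!rcons_cat !word_fun_rcons !map_cat /= xx'.
Qed.

(* Only letters before the last one get multiplied on the right, so the second
   component does not matter. *)
Definition word_rmul (x : L) (a : K) : L := (ra x.1 a, 0).

Section Additive.
Variables (Z : zmodType) (g : forall p, {additive BW p -> Z}).
Local Notation gs := (tensor_seq g).

Lemma tensor_seq_upd s k u w :
  g _ (pure ra (upd (in_tuple s) k u) w) = gs (take k s ++ u :: drop k.+1 s) w.
Proof. by rewrite -(tensor_seqE g) val_upd. Qed.

(** The varying letter becomes an update of one fixed tuple, with placeholder 0, which is the form
    of the relations in [balanced]. *)
Let cat_upd (b c : seq U) : exists2 k : 'I_(size (b ++ 0 :: c)), k = size b :> nat &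
  forall u w, gs (b ++ u :: c) w = g _ (pure ra (upd (in_tuple (b ++ 0 :: c)) k u) w).
Proof.
have kp : (size b < size (b ++ 0%R :: c))%N by rewrite size_cat /= addnS ltnS leq_addr.
exists (Ordinal kp) => // u w.
by rewrite tensor_seq_upd /= take_size_cat // drop_cat ltnNge leqnSn /= subSnn /= drop0.
Qed.

Let morphB (V : zmodType) (h : V -> Z) : {morph h : x y / x + y} -> zmod_morphism h.
Proof. by move=> hD x y; apply/(canRL (addrK _)); rewrite -hD subrK. Qed.

Lemma tensor_seq_addl b c w : zmod_morphism (fun u => gs (b ++ u :: c) w).
Proof.
apply: morphB => u u'; have [k _ kE] := cat_upd b c; rewrite !kE.
by rewrite (balanced_addl (pure_balanced W ra _)) raddfD.
Qed.

Lemma tensor_seq_addr b : zmod_morphism (gs b).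
Proof.
apply: morphB => u u'; rewrite /tensor_seq.
by rewrite (balanced_addr (pure_balanced W ra _)) raddfD.
Qed.

Lemma tensor_seq_mid b x a y c w :
  gs (b ++ ra x a :: y :: c) w = gs (b ++ x :: a *: y :: c) w.
Proof.
set s := b ++ x :: y :: c.
have sp : size s = (size b + (size c).+2)%N by rewrite size_cat.
have k0 : (size b < size s)%N by rewrite sp addnS ltnS leq_addr.
have k1 : ((size b).+1 < size s)%N by rewrite sp !addnS !ltnS leq_addr.
have := balanced_mid (pure_balanced W ra _) (in_tuple s) a w
  (erefl : Ordinal k1 = (Ordinal k0).+1 :> nat).
move=> /(congr1 (g _)); rewrite !tensor_seq_upd !(tnth_nth 0) /=.
rewrite /s take_size_cat // !nth_cat ltnn ltnNge leqnSn subnn subSnn /=.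
rewrite drop_cat ltnNge leqnSn subSnn /= ?drop0.
rewrite take_cat ltnNge leqnSn subSnn /= ?take0 drop_cat ltnNge.
by rewrite (leq_trans (leqnSn _) (leqnSn _)) /= -addn2 addKn /= ?drop0 -catA.
Qed.

Lemma tensor_seq_last b x a w : gs (rcons b (ra x a)) w = gs (rcons b x) (a *: w).
Proof.
set s := rcons b x.
have k0 : (size b < size s)%N by rewrite size_rcons.
have := balanced_last (pure_balanced W ra _) (in_tuple s) a w
  (size_rcons _ _ : _ = (Ordinal k0).+1 :> nat).
move=> /(congr1 (g _)); rewrite tensor_seq_upd (tnth_nth 0) /=.
rewrite /s nth_rcons ltnn eqxx -[take _ _]/(take _ _) -cats1 take_size_cat //.
by rewrite drop_oversize ?size_cat ?addn1 // cats1.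
Qed.

Lemma word_fun_additive : multiadditive (word_fun gs).
Proof.
move=> b; case/lastP => [|c l] x y; rewrite ?cats1 -?rcons_cons -?rcons_cat.
  by rewrite !word_fun_rcons tensor_seq_addr.
by rewrite !word_fun_rcons !map_cat /= tensor_seq_addl.
Qed.

(** On words [balanced_mid] and [balanced_last] merge into one relation; they differ in whether [y]
    is the last letter. *)
Lemma word_fun_mid b x x' a y c : x'.1 = ra x.1 a ->
  word_fun gs (b ++ x' :: y :: c) = word_fun gs (b ++ x :: a *: y :: c).
Proof.
case: x' => u w /= ->; case/lastP: c => [|c l].
  rewrite -[[:: _; y]]/(rcons [:: _] y) -[[:: x; _]]/(rcons [:: _] _) -!rcons_cat.
  by rewrite !word_fun_rcons !map_cat /= !cats1 tensor_seq_last.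
rewrite -!rcons_cons -!rcons_cat.
by rewrite !word_fun_rcons !map_cat /= tensor_seq_mid.
Qed.

End Additive.
End TensorWords.

Lemma dropl_cat (T : Type) n (s t : seq T) : (n <= size s)%N ->
  drop n (s ++ t) = drop n s ++ t.
Proof.
by rewrite drop_cat leq_eqVlt => /predU1P[->|->] //; rewrite ltnn subnn drop0 drop_size.
Qed.

Lemma val_mktuple_nat (T : Type) n (f : nat -> T) :
  [tuple f k | k < n] = mkseq f n :> seq T.
Proof. by rewrite /= /mkseq -val_enum_ord -map_comp. Qed.

Lemma mkseq_nth_drop (T : Type) (x0 : T) s j n : (j + n <= size s)%N ->
  mkseq (fun k => nth x0 s (j + k)) n = take n (drop j s).
Proof.
move=> jn; have ns : (n <= size (drop j s))%N.
  by rewrite size_drop leq_subRL ?(leq_trans _ jn) ?leq_addr.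
apply: (@eq_from_nth _ x0) => [|k]; rewrite size_mkseq ?size_takel // => kn.
by rewrite nth_mkseq // nth_take // nth_drop.
Qed.

Lemma block_op_cat (L Z : Type) (sgn : L -> L) (m : seq L -> L) (F : seq L -> Z) i j b z :
  block_op sgn m F i (size b + j) (b ++ z) =
  block_op sgn m (fun y => F (map sgn b ++ y)) i j z.
Proof.
rewrite /block_op take_cat drop_cat ltnNge leq_addr /= addKn.
by rewrite map_cat -catA.
Qed.

(** * Operations on letters and their compatibility with the tensor relations *)

Section LetterOperations.
Variables (K : pzRingType) (U W : lmodType K) (ra : U -> K -> U).
Local Notation BU := (tensor U ra).
Local Notation BW := (tensor W ra).
Local Notation L := (U * W)%type.

(* The sign [sgnW] on the last factor occurs in no tensor: it is a free parameter. *)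
Variables (sgn : U -> U) (sgnW : W -> W).
Variables (mU : forall i, {additive BU i.-1 -> U}).
Variable mW : forall i, {additive BW i.-1 -> W}.

Definition letter_sgn (x : L) : L := (sgn x.1, sgnW x.2).

(** [word_fun] reads the second component of the last letter; an operation with values in [U] takes
    its last argument from [U] too. *)
Definition diag_letter (x : L) : U * U := (x.1, x.1).

(* The first component is used when the block [z] stops before the last letter of
   a word, the second one when it contains that letter. *)
Definition letter_op (z : seq L) : L :=
  (word_fun (tensor_seq (fun p => mU p.+1)) (map diag_letter z),
   word_fun (tensor_seq (fun p => mW p.+1)) z).

Lemma letter_op_rcons z l : letter_op (rcons z l) =
  (tensor_seq (fun p => mU p.+1) (map fst z) l.1,
   tensor_seq (fun p => mW p.+1) (map fst z) l.2).
Proof. by rewrite /letter_op map_rcons !word_fun_rcons -map_comp. Qed.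

Lemma letter_op_additive : multiadditive letter_op.
Proof.
move=> b c x y; rewrite /letter_op !map_cat /=; congr (_, _).
  exact: (word_fun_additive (fun p => mU p.+1) (map diag_letter b)
    (map diag_letter c) (diag_letter x) (diag_letter y)).
exact: (word_fun_additive (fun p => mW p.+1) b c x y).
Qed.

Lemma letter_op_mid b x a y c :
  letter_op (b ++ word_rmul ra x a :: y :: c) = letter_op (b ++ x :: a *: y :: c).
Proof.
rewrite /letter_op !map_cat /=; congr (_, _).
  exact: (word_fun_mid (fun p => mU p.+1)).
exact: (word_fun_mid (fun p => mW p.+1)).
Qed.

Definition word_balanced (Z : Type) (F : seq L -> Z) : Prop := forall b x a y c,
  F (b ++ word_rmul ra x a :: y :: c) = F (b ++ x :: a *: y :: c).

Local Notation block_op := (block_op letter_sgn letter_op).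

Hypotheses (sgnB : zmod_morphism sgn) (sgnWB : zmod_morphism sgnW).

(** The varying letter lies before, inside or after the block, and accordingly goes through the
    sign, through [letter_op], or unchanged into [F]. *)
Lemma block_op_additive (Z : zmodType) (F : seq L -> Z) i j :
  multiadditive F -> multiadditive (block_op F i j).
Proof.
move=> Fadd b c x y; case: (ltnP (size b) j) => [|jb].
  move=> /subnKC <-; rewrite addSnnS !block_op_cat /block_op /=.
  rewrite -[RHS](Fadd (map letter_sgn b)); congr (F (_ ++ _ :: _)).
  by rewrite /letter_sgn /= sgnB sgnWB.
have [b0 [b1 [jb0 ->]]] : exists b0 b1, j = size b0 /\ b = b0 ++ b1.
  by exists (take j b), (drop j b); rewrite size_takel // cat_take_drop.
rewrite jb0 -[size b0]addn0 -!catA !block_op_cat /block_op /= !take0 !drop0 /=.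
case: (ltnP (size b1) i) => [/subnKC <-|ib1].
  rewrite addSnnS !take_cat !drop_cat ltnNge leq_addr addKn /= letter_op_additive.
  exact: Fadd.
rewrite !takel_cat // !dropl_cat // -!cat_cons !catA; exact: Fadd.
Qed.

Hypothesis sgnZ : forall a u, sgn (a *: u) = a *: sgn u.
Hypothesis sgnWZ : forall a w, sgnW (a *: w) = a *: sgnW w.
Hypothesis sgn_ra : forall a u, sgn (ra u a) = ra (sgn u) a.
Hypothesis letter_op_left : forall a x b,
  letter_op (a *: x :: b) = a *: letter_op (x :: b).
Hypothesis letter_op_right : forall a x b,
  (letter_op (rcons b (word_rmul ra x a))).1 = ra (letter_op (rcons b x)).1 a.

(** If both neighbours lie on the same side of the block, or inside it, the relation passes through
    directly. If the block starts or ends between them, [letter_op_left] or [letter_op_right]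
    carries the scalar across. *)
Lemma block_op_balanced (Z : zmodType) (F : seq L -> Z) i j : (0 < i)%N ->
  word_balanced F -> word_balanced (block_op F i j).
Proof.
move=> i0 Fbal b x a y c.
have sgnr u : letter_sgn (word_rmul ra u a) = word_rmul ra (letter_sgn u) a.
  by rewrite /letter_sgn /word_rmul /= sgn_ra -[X in sgnW X](subrr 0) sgnWB subrr.
case: (ltnP (size b) j) => [|jb].
  move=> /subnKC <-; rewrite addSnnS !block_op_cat /block_op /= sgnr.
  case: (_ - _)%N => [|j'] /=; last first.
    rewrite Fbal; congr (F (_ ++ _ :: _ :: _)).
    by rewrite /letter_sgn /= sgnZ sgnWZ.
  by case: i i0 => // i _ /=; rewrite letter_op_left Fbal.
have [b0 [b1 [jb0 ->]]] : exists b0 b1, j = size b0 /\ b = b0 ++ b1.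
  by exists (take j b), (drop j b); rewrite size_takel // cat_take_drop.
rewrite jb0 -[size b0]addn0 -!catA !block_op_cat /block_op /= !take0 !drop0 /=.
case: (ltnP (size b1) i) => [/subnKC <-|ib1].
  rewrite addSnnS !take_cat !drop_cat ltnNge leq_addr addKn /=.
  case: (_ - _)%N => [|i'] /=; last by rewrite letter_op_mid.
  rewrite -Fbal ?take0 ?drop0 !cats1; congr (F (_ ++ _ :: _)).
  rewrite [LHS]surjective_pairing letter_op_right; congr (_, _).
  (* The second component of [word_rmul] is 0, so an operation is evaluated at 0 in its last
     argument. *)
  rewrite [LHS]word_fun_rcons /=.
  have := tensor_seq_addr (fun p => mW p.+1) (map fst b1) 0 0.
  by rewrite !subrr.
rewrite !takel_cat // !dropl_cat // -!cat_cons !catA; exact: Fbal.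
Qed.

(** The function lifted in [bar_insert] is first computed on words ([fE]). Its balancedness, without
    which [tensor_lift] defaults to 0, then follows from that of [block_op]. *)
Lemma bar_insert_word (Z : zmodType) (g : forall p, {additive BW p -> Z})
    p i j (v : p.-tuple L) (l : L) : (0 < i)%N -> (i + j <= p.+1)%N ->
  g (p.+1 - i)%N (bar_insert sgn (fun i => mU i) (fun i => mW i) p i j
    (pure ra [tuple of map fst v] l.2)) =
  block_op (word_fun (tensor_seq g)) i j (rcons v l).
Proof.
case: i => // i _ ijp; rewrite /bar_insert; set f := (fun v w => _).
have fE (Y : zmodType) (h : forall p, {additive BW p -> Y}) (s : p.-tuple L) k :
    h _ (f [tuple of map fst s] k.2) =
    block_op (word_fun (tensor_seq h)) i.+1 j (rcons s k).
  have jp : (j <= p)%N.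
    by rewrite -ltnS (leq_trans _ ijp) // -[X in (X < _)%N]add0n ltn_add2r.
  have ip : (i.+1 <= p.+1)%N by rewrite (leq_trans (leq_addr _ _) ijp).
  rewrite /f /block_op -cats1 takel_cat ?size_tuple // dropl_cat ?size_tuple //.
  have sE (q n : nat) : (q + n <= p)%N ->
    mkseq (fun k => nth 0 (map fst s) (q + k)) n = map fst (take n (drop q s)).
    by move=> qn; rewrite mkseq_nth_drop ?size_map ?size_tuple // -map_drop -map_take.
  have sgnE : mkseq (fun k => sgn (nth 0 (map fst s) k)) j =
      map fst (map letter_sgn (take j s)).
    rewrite -map_comp (map_comp sgn fst) -{2}[val s]drop0 -(sE 0%N) ?add0n //.
    by rewrite -map_comp.
  (* With arity [i.+1] the block reaches the last letter exactly when [j = p - i]; then [mW] acts,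
     otherwise [mU]. *)
  case: eqP => [jE|jN].
    have iE : i.+1 = (size (drop j s)).+1.
      by rewrite size_drop size_tuple -subSn // jE subKn.
    have sk : (size (drop j s ++ [:: k]) <= i.+1)%N by rewrite size_cat addn1 iE.
    rewrite (take_oversize sk) (drop_oversize sk).
    rewrite !cats1 word_fun_rcons -(tensor_seqE h).
    rewrite (val_mktuple_nat _ (fun k => sgn (nth 0 (map fst s) k))).
    rewrite -jE sgnE; congr tensor_seq.
    rewrite [RHS]word_fun_rcons /=; case: iE => iE.
    rewrite -(tensor_seqE (fun p => mW p.+1)).
    rewrite (val_mktuple_nat _ (fun q => nth 0 (map fst s) (j + q))) sE.
      by rewrite take_oversize ?iE.
    by rewrite /= iE size_drop size_tuple subnKC.
  have ijp' : (i.+1 + j <= p)%N.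
    rewrite -ltnS ltn_neqAle ijp andbT; apply/eqP => ijE; apply: jN.
    by rewrite -ijE addKn.
  have ids : (i.+1 <= size (drop j s))%N.
    by rewrite size_drop size_tuple leq_subRL // [(j + _)%N]addnC.
  rewrite takel_cat // dropl_cat // -cat_cons catA cats1 word_fun_rcons.
  rewrite -(tensor_seqE h); congr tensor_seq.
  rewrite (val_mktuple_nat _ (fun q => if (q < j)%N then sgn (nth 0 (map fst s) q)
    else if q == j then mU i.+1 (pure ra
      [tuple nth 0 (map fst s) (j + l0) | l0 < i] (nth 0 (map fst s) (j + i)))
    else nth 0 (map fst s) (q + i))).
  rewrite map_cat /= -sgnE !map_drop drop_drop.
  set y := mU _ _; set y' := word_fun _ _.
  have <- : y = y'.
    rewrite /y /y' -(tensor_seqE (fun p => mU p.+1)).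
    rewrite (val_mktuple_nat _ (fun q => nth 0 (map fst s) (j + q))) sE; last first.
      by rewrite addnC ltnW.
    rewrite (take_nth k); last by rewrite -ltnS.
    rewrite map_rcons word_fun_rcons -!map_comp /=; congr tensor_seq.
    by rewrite nth_drop (nth_map k) // size_tuple addnC.
  apply: (@eq_from_nth _ 0) => [|q]; rewrite size_mkseq.
    rewrite size_cat size_mkseq /= size_drop size_map size_tuple.
    by move: ijp'; clear; lia.
  move=> qp; rewrite nth_mkseq // nth_cat size_mkseq.
  case: ltngtP => [qj|jq|->]; first by rewrite nth_mkseq.
    rewrite -(subnSK jq) /= nth_drop; congr (nth _ _ _).
    by move: jq; clear; lia.
  by rewrite subnn.
(* [fE] needs a family of maps to one group. The inclusions into the direct sum form one, and being
   injective they reflect the equations to be proved. *)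
pose inj q : {additive BW q -> dsum (fun q => BW q : zmodType)} := dsum_inj q.
have injI q (x y : BW q) : inj q x = inj q y -> x = y.
  by move=> /(congr1 (fun z => dsum_fun z q)); rewrite !dsum_injE.
pose emb (u : U) : L := (u, 0).
pose F := block_op (word_fun (tensor_seq inj)) i.+1 j.
have FE s w : inj _ (f s w) = F (rcons (map emb s) (0, w)).
  rewrite /F -(fE _ inj [tuple of map emb s] (0, w)) /=; congr (dsum_inj _ (f _ _)).
  by apply: val_inj; rewrite /= -map_comp map_id.
have Fadd : multiadditive F by apply/block_op_additive/word_fun_additive.
have Fbal : word_balanced F.
  by apply: block_op_balanced => // b x a y c; apply: word_fun_mid.
have FD b c x y : F (b ++ (x + y) :: c) = F (b ++ x :: c) + F (b ++ y :: c).
  by apply/(canRL (subrK _)); rewrite -(Fadd b c) addrK.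
have fbal : balanced ra f.
  split=> [s q u u' w|s w w'|s q n a w nq|s q a w pq]; apply: injI; rewrite ?raddfD !FE.
  - rewrite !val_upd !map_cat /= !rcons_cat /= -FD; congr (F (_ ++ _ :: _)).
    by rewrite /emb -[X in (_, X)]addr0.
  - rewrite -!cats1 -FD; congr (F (_ ++ [:: _])).
    by rewrite -[X in (X, _)]addr0.
  - have ks : (q < size s)%N by rewrite size_tuple.
    have ns : (q.+1 < size s)%N by rewrite -nq size_tuple.
    rewrite !val_upd nq (take_nth 0 ks) (drop_nth 0 ns) -nq !(tnth_nth 0).
    rewrite cat_rcons !map_cat /= !rcons_cat /= -[emb (ra _ _)]/(word_rmul ra (emb _) a).
    rewrite Fbal; congr (F (_ ++ _ :: _ :: _)).
    by apply: injective_projections => //=; rewrite scaler0.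
  - have ks : (q < size s)%N by rewrite size_tuple.
    have sE : s = rcons (take q s) (tnth s q) :> seq U.
      by rewrite (tnth_nth 0) -take_nth // take_oversize // size_tuple -[leqRHS]pq.
    rewrite val_upd [in RHS]sE drop_oversize ?size_tuple -?[leqRHS]pq // map_cat map_rcons /=.
    rewrite -[emb (ra _ _)]/(word_rmul ra (emb _) a) cats1 -!cats1 -!catA Fbal.
    congr (F (_ ++ [:: _; _])).
    by apply: injective_projections => //=; rewrite scaler0.
by rewrite tensor_liftE.
Qed.

Lemma wdiff_word (Z : zmodType) (g : forall p, {additive BW p -> Z})
    p (v : p.-tuple L) (l : L) :
  \sum_(1 <= i < p.+2) g (p.+1 - i)%N
     (bar_term sgn (fun i => mU i) (fun i => mW i) i (pure ra [tuple of map fst v] l.2)) =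
  wdiff letter_sgn letter_op (word_fun (tensor_seq g)) (rcons v l).
Proof.
have sz : size (rcons v l) = p.+1 by rewrite size_rcons size_tuple.
rewrite wdiff_nat sz; apply: eq_big_nat => i /andP[i0 ip].
rewrite raddf_sum; apply: eq_big_nat => j jp; apply: bar_insert_word => //.
by rewrite -leq_subRL.
Qed.

End LetterOperations.

Lemma wdiff_map (L L' : Type) (Z : zmodType) (e : L -> L') (sgn : L -> L)
    (sgn' : L' -> L') (m : seq L -> L) (m' : seq L' -> L') (F : seq L' -> Z) s :
  (forall x, e (sgn x) = sgn' (e x)) ->
  (forall x y, e (m (x :: y)) = m' (map e (x :: y))) ->
  wdiff sgn' m' F (map e s) = wdiff sgn m (fun y => F (map e y)) s.
Proof.
move=> esgn em; elim: s F => //= x s IHs F; rewrite -esgn IHs; congr (_ + _).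
have -> (G : seq L' -> seq L' -> Z) : split_sum G (map e s) =
    split_sum (fun b c => G (map e b) (map e c)) s.
  by elim: s G {IHs} => //= y s IHs G; rewrite IHs.
by apply: eq_split_sum => b c _; rewrite -em.
Qed.

(** * The Stasheff identities for words *)

Section Commutative.
Variables (Q : comPzRingType) (V W : lmodType Q).
Local Notation ra := (fun (v : V) (a : Q) => a *: v).

Section Scaling.
Variables (Y : lmodType Q) (g : forall p, {linear qtensor V W p -> Y}).

Lemma qtensor_seqZr s a w :
  tensor_seq (ra := ra) g s (a *: w) = a *: tensor_seq (ra := ra) g s w.
Proof. by rewrite /tensor_seq -[pure _ _ (_ *: _)]/(qpure _ _) qpureZ linearZ. Qed.

Lemma qtensor_seqZl a b v s w :
  tensor_seq (ra := ra) g (b ++ a *: v :: s) w = a *: tensor_seq (ra := ra) g (b ++ v :: s) w.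
Proof.
have bp : (size b < size (b ++ v :: s))%N by rewrite size_cat /= addnS ltnS leq_addr.
have := qpure_updZ a (in_tuple (b ++ v :: s)) (Ordinal bp) w.
move=> /(congr1 (g _)); rewrite linearZ => <-.
have /= := tensor_seq_upd g (s := b ++ v :: s) (Ordinal bp) (a *: v) w.
rewrite take_size_cat // drop_cat ltnNge leqnSn subSnn /= drop0 => <-.
by rewrite /qpure (tnth_nth 0) /= nth_cat ltnn subnn.
Qed.

Lemma qword_funZ a x s :
  word_fun (tensor_seq (ra := ra) g) (a *: x :: s) =
  a *: word_fun (tensor_seq (ra := ra) g) (x :: s).
Proof.
case/lastP: s => [|s l]; first exact: qtensor_seqZr.
by rewrite -!rcons_cons !word_fun_rcons /= (qtensor_seqZl a [::]).
Qed.
End Scaling.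
End Commutative.

Section CommutativeOperations.
Variables (Q : comPzRingType) (V W : lmodType Q).
Local Notation ra := (fun (v : V) (a : Q) => a *: v).

Variables (m : forall i, {linear qtensor V V i.-1 -> V}).
Variables (mW : forall i, {linear qtensor V W i.-1 -> W}).

Local Notation op := (letter_op (ra := ra) m mW).

Lemma qletter_op_left a x b : op (a *: x :: b) = a *: op (x :: b).
Proof.
apply: injective_projections => /=; last exact: (qword_funZ (fun p => mW p.+1)).
exact: (qword_funZ (fun p => m p.+1) a (diag_letter x)).
Qed.

Lemma qletter_op_right a x b :
  (op (rcons b (word_rmul ra x a))).1 = a *: (op (rcons b x)).1.
Proof.
rewrite /= !map_rcons !word_fun_rcons /=; exact: (qtensor_seqZr (fun p => m p.+1)).
Qed.

End CommutativeOperations.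

(** Letters are reduced to generators from left to right; the accumulator of the induction holds the
    generators already reached. *)
Lemma word_ext (L Z : zmodType) (T : Type) (e : T -> L) (F F' : seq L -> Z) :
  (forall P : L -> Prop, P 0 -> (forall x y, P x -> P y -> P (x - y)) ->
     (forall t, P (e t)) -> forall x, P x) ->
  multiadditive F -> multiadditive F' ->
  (forall t, F (map e t) = F' (map e t)) -> F =1 F'.
Proof.
move=> eP Fadd F'add FF' s; rewrite -[s]cat0s -[[::]]/(map e [::]).
elim: s [::] => [|x s IHs] a; first by rewrite cats0.
elim/eP: x => [|x y Fx Fy|t]; last by rewrite -cat_rcons -map_rcons.
  by rewrite -(subrr 0) Fadd F'add !subrr.
by rewrite Fadd F'add Fx Fy.
Qed.

(** * Koszul signs *)

Section Signs.
Variables (Q : comPzRingType) (Ap : nat -> lmodType Q).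
Local Notation V := (gtotal Ap).
Local Notation ra := (fun (v : V) (a : Q) => a *: v).

Fact koszul_additive s : zmod_morphism (@koszul _ Ap s).
Proof. by move=> x y; apply: dsumP => n; apply: scalerBr. Qed.

Lemma koszulZ s a (x : V) : koszul s (a *: x) = a *: koszul s x.
Proof. by apply: dsumP => n /=; rewrite !scalerA (commr_sign a). Qed.

Lemma koszulK s : involutive (@koszul _ Ap s).
Proof. by move=> x; apply: dsumP => n /=; rewrite scalerA -expr2 sqrr_sign scale1r. Qed.

Lemma koszul_homogeneous s e (x : V) : homogeneous s e x ->
  koszul s x = (-1) ^+ `|e|%N *: x.
Proof.
move=> xe; apply: dsumP => n /=; have [<-|/xe ->] := pselect ((n + s)%N%:Z = e).
  by rewrite absz_nat.
by rewrite !scaler0.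
Qed.

Lemma homogeneous_inj s n (u : Ap n) :
  homogeneous s (n + s)%N (dsum_inj n u : V).
Proof. by move=> k kn; apply: dsum_inj_neq => nk; apply: kn; rewrite nk. Qed.

Variables (m : forall i, {linear qtensor V V i.-1 -> V}).
Hypothesis m_degree : operations_degree m 2.

Local Notation M := (fun s : seq V =>
  word_fun (tensor_seq (ra := ra) (fun p => m p.+1)) (map (fun v => (v, v)) s)).

(** An operation of degree -1 changes the parity of the total degree. Both sides are multiadditive,
    so [word_ext] reduces the claim to words of homogeneous letters. *)
Lemma koszul_operation s : koszul 2 (M s) = - M (map (koszul 2) s).
Proof.
pose e (t : {n : nat & Ap n}) : V := dsum_inj (tag t) (tagged t).
have Madd : multiadditive M.
  move=> b c x y; rewrite !map_cat.
  exact: (word_fun_additive (fun p => m p.+1) _ _ (x, x) (y, y)).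
have Mrcons b x : M (rcons b x) = tensor_seq (ra := ra) (fun p => m p.+1) b x.
  by rewrite map_rcons word_fun_rcons /= -map_comp map_id.
have MZ b a x c : M (b ++ a *: x :: c) = a *: M (b ++ x :: c).
  case/lastP: c => [|c l].
    by rewrite !cats1 !Mrcons (qtensor_seqZr (fun p => m p.+1)).
  by rewrite -!rcons_cons -!rcons_cat !Mrcons (qtensor_seqZl (fun p => m p.+1)).
apply: (word_ext (e := e) (F := fun s => koszul 2 (M s))
  (F' := fun s => - M (map (koszul 2) s))) s => [P P0 PB Pe x|b c x y|b c x y|t].
- elim/dsum_ind: x => [//|y z Py Pz|n u]; last exact: (Pe (existT _ n u)).
  by rewrite -[z]opprK; apply: (PB) => //; rewrite -sub0r; apply: (PB).
- by rewrite Madd koszul_additive.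
- by rewrite !(map_cat (@koszul _ _ _)) /= koszul_additive Madd opprD.
have Msgn b : M (b ++ map (koszul 2) (map e t)) =
    (-1) ^+ (\sum_(i <- t) (tag i + 2)) *: M (b ++ map e t).
  elim: t b => [|i t IHt] b; first by rewrite big_nil scale1r.
  rewrite big_cons exprD /= (koszul_homogeneous (@homogeneous_inj 2 _ _)) absz_nat.
  by rewrite MZ -cat_rcons IHt cat_rcons scalerA.
rewrite (Msgn [::]) /=.
case/lastP: t {Msgn} => [|t x].
  by rewrite /= scaler0 oppr0; apply: dsumP => n; exact: scaler0.
have -> : koszul 2 (M (map e (rcons t x))) =
    (-1) ^+ `|(\sum_(i <- t) (tag i + 2) + (tag x + 2))%N%:Z - 1|%N *: M (map e (rcons t x)).
  apply: koszul_homogeneous; rewrite map_rcons Mrcons.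
  rewrite -[map e t]/(tval [tuple of map e (in_tuple t)]) (tensor_seqE (fun p => m p.+1)).
  rewrite PoszD.
  have := @m_degree (size t).+1 [tuple of map e (in_tuple t)] (e x)
    [tuple of map (fun i => (tag i + 2)%N%:Z) (in_tuple t)] (tag x + 2)%N%:Z isT.
  rewrite (_ : \sum_(k < _) tnth _ k = (\sum_(i <- t) (tag i + 2))%N%:Z); last first.
    rewrite (big_morph Posz PoszD (erefl _)) -[in RHS](in_tupleE t) big_tuple.
    by apply: eq_bigr => k _; rewrite tnth_map.
  apply; last exact: homogeneous_inj.
  by move=> k; rewrite !tnth_map; apply: homogeneous_inj.
(* The shifted degree of the last letter is at least 2, so the total degree is a successor and the
   absolute value of total degree minus one is its predecessor. *)
rewrite -cats1 big_cat big_seq1 /= addn2 [(_ + _.+2)%N]addnS.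
rewrite -[X in `|X|%N]/(_.+1%:Z - 1) -addn1 PoszD addrK absz_nat addn1.
by rewrite exprS mulN1r scaleNr opprK.
Qed.
End Signs.

Section StasheffWords.
Variables (Q : comPzRingType) (Ap G : nat -> lmodType Q).
Local Notation V := (gtotal Ap).
Local Notation W := (gtotal G).
Local Notation L := (V * W)%type.
Local Notation ra := (fun (v : V) (a : Q) => a *: v).

Variables (m : algebra_operations Ap) (mG : module_operations Ap G).

Local Notation op := (letter_op (ra := ra) m mG).
Local Notation sg := (letter_sgn (@koszul _ Ap 2) id).

(** The last argument never takes a sign, so [sgnH] may be chosen: the identity in [stasheff_snd],
    and [koszul 2] in [stasheff_fst], where signs must preserve diagonal letters. *)
Let stasheff_wdiff (H : nat -> lmodType Q) (mH : module_operations Ap H)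
    (sgnH : gtotal H -> gtotal H) p (v : p.-tuple (V * gtotal H)) l :
  zmod_morphism sgnH -> (forall a x, sgnH (a *: x) = a *: sgnH x) ->
  stasheff m mH (qpure [tuple of map fst v] l.2) =
  (wdiff (letter_sgn (@koszul _ Ap 2) sgnH) (letter_op (ra := ra) m mH)
     (letter_op (ra := ra) m mH) (rcons v l)).2.
Proof.
move=> sgnHB sgnHZ; rewrite -[RHS]/(snd _) raddf_wdiff /=.
rewrite -(wdiff_word _ _ _ _ _ _ _ (fun p => mH p.+1)) //.
- exact: koszul_additive.
- by move=> a u; apply: koszulZ.
- by move=> a u; apply: koszulZ.
- exact: qletter_op_left.
- exact: qletter_op_right.
Qed.

Lemma stasheff_snd p (v : p.-tuple L) l :
  (wdiff sg op op (rcons v l)).2 = stasheff m mG (qpure [tuple of map fst v] l.2).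
Proof. by rewrite (@stasheff_wdiff _ _ id). Qed.

(** The first component is the second one for the algebra acting on itself, evaluated on diagonal
    letters; [wdiff_map] transports along [diag_letter]. *)
Lemma stasheff_fst p (v : p.-tuple L) l :
  (wdiff sg op op (rcons v l)).1 = stasheff m m (qpure [tuple of map fst v] l.1).
Proof.
have -> : [tuple of map fst v] = [tuple of map fst [tuple of map (@diag_letter _ _ _) v]].
  by apply: val_inj; rewrite /= -map_comp.
rewrite (@stasheff_wdiff Ap m (koszul 2) _ _ (diag_letter l)); last 2 first.
- exact: koszul_additive.
- by move=> a u; apply: koszulZ.
rewrite -map_rcons -[LHS]/(fst _) -[RHS]/(snd _) !raddf_wdiff /=.
rewrite (wdiff_map (sgn := sg) (m := op)) //.
by move=> x y; congr (_, _); rewrite -!map_comp.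
Qed.

Lemma letter_op1 x : op [:: x] = (m 1%N (qpure [tuple] x.1), mG 1%N (qpure [tuple] x.2)).
Proof.
congr (_, _); rewrite /= /tensor_seq /=; congr (_ (pure _ _ _)); exact: val_inj.
Qed.

End StasheffWords.

Section StasheffRelations.
Variables (Q R : comPzRingType) (pi : {rmorphism Q -> R}) (M : lmodType R).
Variables (Ap G : nat -> lmodType Q).
Variable dA : forall n, {linear with_unit Ap n.+1 -> with_unit Ap n}.
Hypothesis A_resolution : projective_resolution dA (pi : with_unit Ap 0 -> R).
Variables (dG : forall n, {linear G n.+1 -> G n}).
Variable eps : {linear G 0%N -> M | pi \; *:%R}.
Hypothesis G_resolution : projective_resolution dG eps.
Variables (m : algebra_operations Ap) (mG : module_operations Ap G).
Hypotheses (m_algebra : a_infinity_algebra dA m) (mG_module : a_infinity_module dA dG m mG).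
Local Notation V := (gtotal Ap).
Local Notation L := (V * gtotal G)%type.
Local Notation ra := (fun (v : V) (a : Q) => a *: v).
Local Notation op := (letter_op (ra := ra) m mG).
Local Notation sg := (letter_sgn (@koszul _ Ap 2) id).

(** One letter gives the square of a differential, zero by exactness of the resolutions. Three or
    more letters give a vanishing Stasheff relation, and two letters leave the terms in [d1A]. *)
Lemma wdiff_letter_op z :
  wdiff sg op op z =
  if z is [:: x; y] then (d1A dA x.1 *: y.1 - d1A dA y.1 *: x.1, d1A dA x.1 *: y.2) else 0.
Proof.
have [_ m1 m2 m3] := m_algebra; have [_ mG1 mG2 mG3] := mG_module.
case/lastP: z => [|[|x s] y]; first by rewrite /= addr0.
  rewrite /= !addr0 !letter_op1; apply: injective_projections; apply: dsumP => n.
    rewrite /= !m1 raddfN opprK.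
    have E := iffRL (@resolution_exact _ _ _ _ _ A_resolution n.+1 (dA n.+2 (y.1 n.+2))).
    by apply: E; exists (y.1 n.+2).
  by rewrite /= !mG1; apply: (iffRL (resolution_exact G_resolution _)); exists (y.2 n.+2).
rewrite [LHS]surjective_pairing.
rewrite (stasheff_fst _ _ (in_tuple (x :: s))) (stasheff_snd _ _ (in_tuple (x :: s))).
case: s => [|x' s]; last first.
  rewrite (@m3 (size s).+3) // (@mG3 (size s).+3) //.
  by case: s.
have -> : [tuple of map fst (in_tuple [:: x])] = [tuple x.1] :> (size [:: x]).-tuple V.
  exact: val_inj.
by rewrite m2 mG2.
Qed.

End StasheffRelations.

(** * Base change and the square of the differential *)

Section BaseChangePure.
Variables (Q : comPzRingType) (S : pzRingType) (f : algebra_map Q S).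
Variables (U : lmodType Q) (N : lmodType S).
Implicit Types (u : U) (n : N).

Lemma bpureBl u u' n : bpure f (u - u') n = bpure f u n - bpure f u' n.
Proof. by apply/(canRL (addrK _)); rewrite -bpureDl subrK. Qed.

Lemma bpureZ_eq0 a u n : f a = 0 -> bpure f (a *: u) n = 0.
Proof. by move=> fa; rewrite bpureZ fa -bpureZr scale0r. Qed.

End BaseChangePure.

Section BaseChangeWords.
Variables (Q : comPzRingType) (S : pzRingType) (f : algebra_map Q S).
Variables (V : lmodType Q).
Local Notation SV := (bchange f V S^o).
Local Notation sra := (@bchange_rmul Q S f V).
Local Notation ra := (fun (v : V) (a : Q) => a *: v).

Definition bgen (x : V * S) : SV := bpure f x.1 (x.2 : S^o).

(** The property by which [base_change] was chosen, on words: the scalars from [S] are collected, in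
    order, in the last factor. *)
Lemma base_change_seq (W : lmodType Q) (N : lmodType S)
    (phi : forall p, {linear qtensor V W p -> W}) (t : seq (V * S)) w n :
  tensor_seq (ra := sra) (fun p => base_change f N (phi p)) (map bgen t) (bpure f w n) =
  bpure f (tensor_seq (ra := ra) phi (map fst t) w) ((\prod_(x <- t) x.2) *: n).
Proof.
have := svalP (cid (extends_scalars_exists f N (phi (size t))))
  [tuple of map fst (in_tuple t)] [tuple of map snd (in_tuple t)] w n.
rewrite -[sval _]/(base_change f N (phi (size t))) /spure /qpure.
rewrite -(tensor_seqE (fun p => base_change f N (phi p))) -(tensor_seqE phi).
rewrite -[in \prod_(x <- t) _](in_tupleE t) big_tuple.
under eq_bigr do rewrite tnth_map.
move=> <-; congr tensor_seq.
apply: (@eq_from_nth _ 0) => [|k]; rewrite size_map; first exact/esym/size_tuple.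
move=> kt.
rewrite (nth_map (0, 0)) // -(tnth_nth 0 _ (Ordinal kt)) tnth_mktuple !tnth_map.
by rewrite !(tnth_nth (0, 0)).
Qed.

End BaseChangeWords.

Arguments bgen {Q S} f {V} x.

(** * The bar complex over [S] in terms of words *)

Section BarComplexWords.
Variables (Q : comPzRingType) (S : pzRingType) (f : algebra_map Q S).
Variables (N : lmodType S) (Ap G : nat -> lmodType Q).
Variables (m : algebra_operations Ap) (mG : module_operations Ap G).
Local Notation V := (gtotal Ap).
Local Notation W := (gtotal G).
Local Notation SV := (bchange f V S^o).
Local Notation SW := (bchange f W N).
Local Notation sra := (@bchange_rmul Q S f V).
Local Notation ra := (fun (v : V) (a : Q) => a *: v).
Local Notation kz := (@koszul_bar _ _ f Ap).
Local Notation sop := (letter_op (ra := sra) (mbar f m) (mGbar f N mG)).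
Local Notation op := (letter_op (ra := ra) m mG).
Local Notation ssg := (letter_sgn kz (@id SW)).
Local Notation sg := (letter_sgn (@koszul _ Ap 2) (@id W)).

Fact koszul_bar_additive : zmod_morphism kz.
Proof. by move=> x y; rewrite /koszul_bar raddfB. Qed.

Lemma koszul_bar_pure v (s : S^o) : kz (bpure f v s) = bpure f (koszul 2 v) s.
Proof.
apply: bchange_liftE => [u u' n|u n n'|a u n]; last by rewrite koszulZ bpureZ.
  by rewrite -bpureDl; congr bpure; apply/(canRL (subrK _)); rewrite -koszul_additive addrK.
exact: bpureDr.
Qed.

Let koszul_bar0 : kz 0 = 0.
Proof. exact: raddf0. Qed.

Lemma koszul_barZ a x : kz (a *: x) = a *: kz x.
Proof.
elim/bchange_ind: x => [|x y Ex Ey|v s]; first by rewrite koszul_bar0 !scaler0.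
  by rewrite scalerBr !koszul_bar_additive Ex Ey scalerBr.
by rewrite bpureZr !koszul_bar_pure bpureZr.
Qed.

Lemma koszul_bar_rmul a x : kz (sra x a) = sra (kz x) a.
Proof.
elim/bchange_ind: x => [|x y Ex Ey|v s]; first by rewrite koszul_bar0 !rmul0 koszul_bar0.
  by rewrite rmulB !koszul_bar_additive Ex Ey rmulB.
by rewrite bchange_rmul_pure !koszul_bar_pure bchange_rmul_pure.
Qed.

Let sgen_ind (P : SV -> Prop) : P 0 -> (forall x y, P x -> P y -> P (x - y)) ->
  (forall t, P (bgen f t)) -> forall x, P x.
Proof.
by move=> P0 PB Pg; apply: bchange_ind => // v s; apply: (Pg (v, s)).
Qed.

Section Left.
Variables (W' : lmodType Q) (N' : lmodType S).
Variable phi : forall p, {linear qtensor V W' p -> W'}.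
Local Notation F := (tensor_seq (ra := sra) (fun p => base_change f N' (phi p))).

Lemma base_change_seqZ0 a w : F [::] (a *: w) = a *: F [::] w.
Proof.
elim/bchange_ind: w => [|x y Ex Ey|w n].
- by rewrite scaler0 -[X in F _ X](subrr 0) tensor_seq_addr subrr scaler0.
- by rewrite scalerBr !tensor_seq_addr Ex Ey scalerBr.
by rewrite bpureZr !(base_change_seq f phi [::]) bpureZr !scalerA big_nil mul1r mulr1.
Qed.

Lemma base_change_seqZl a x s w : F (a *: x :: s) w = a *: F (x :: s) w.
Proof.
elim/bchange_ind: w => [|w w' Ew Ew'|w n].
- by rewrite -(subrr 0) !tensor_seq_addr !subrr scaler0.
- by rewrite !tensor_seq_addr Ew Ew' scalerBr.
(* The empty word has no first letter to scale; the value 0 makes both functions agree there, as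
   [word_ext] requires. *)
pose F1 z := if z is x :: s then F (a *: x :: s) (bpure f w n) else 0.
pose F2 z := if z is x :: s then a *: F (x :: s) (bpure f w n) else 0.
suff E : F1 =1 F2 by exact: (E (x :: s)).
apply: (word_ext sgen_ind).
- case=> [|y b] c u u' /=; last exact: (tensor_seq_addl _ (_ :: b)).
  by rewrite scalerBr; apply: (tensor_seq_addl _ [::]).
- case=> [|y b] c u u' /=; rewrite -scalerBr; congr (_ *: _).
    exact: (tensor_seq_addl _ [::]).
  exact: (tensor_seq_addl _ (_ :: b)).
case=> [|[v t] s'] //=; rewrite bpureZr.
rewrite (base_change_seq f phi ((v, t) :: s')).
rewrite -[_ :: _]/(map (bgen f) ((v, a * t) :: s')).
by rewrite (base_change_seq f phi) /= !big_cons /= bpureZr scalerA mulrA.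
Qed.

End Left.

Lemma base_change_seq_right (phi : forall p, {linear qtensor V V p -> V}) s x a :
  tensor_seq (ra := sra) (fun p => base_change f S^o (phi p)) s (sra x a) =
  sra (tensor_seq (ra := sra) (fun p => base_change f S^o (phi p)) s x) a.
Proof.
set F := tensor_seq _.
have FB b : zmod_morphism (F b) by apply: tensor_seq_addr.
elim/bchange_ind: x => [|w w' Ew Ew'|v t].
- by rewrite rmul0 -[X in F _ X](subrr 0) FB subrr rmul0.
- by rewrite rmulB !FB Ew Ew' rmulB.
pose F1 s' := F s' (sra (bpure f v t) a); pose F2 s' := sra (F s' (bpure f v t)) a.
suff E : F1 =1 F2 by exact: E.
apply: (word_ext sgen_ind); rewrite /F1 /F2.
- by move=> b c y z; apply: tensor_seq_addl.
- move=> b c y z; rewrite -rmulB; congr (sra _ _); exact: tensor_seq_addl.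
move=> s'; rewrite /F bchange_rmul_pure !(base_change_seq f phi) bchange_rmul_pure.
by congr bpure; rewrite /GRing.scale /= mulrA.
Qed.

Lemma sletter_op_left a x b : sop (a *: x :: b) = a *: sop (x :: b).
Proof.
case/lastP: b => [|b y].
  rewrite -[[:: _]]/(rcons [::] _) -[[:: x]]/(rcons [::] _) !letter_op_rcons.
  apply: injective_projections => /=.
    exact: (base_change_seqZ0 (fun p => m p.+1)).
  exact: (base_change_seqZ0 (fun p => mG p.+1)).
rewrite -!rcons_cons !letter_op_rcons; apply: injective_projections => /=.
  exact: (base_change_seqZl (fun p => m p.+1)).
exact: (base_change_seqZl (fun p => mG p.+1)).
Qed.

Lemma sletter_op_right a x b :
  (sop (rcons b (word_rmul sra x a))).1 = sra (sop (rcons b x)).1 a.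
Proof.
rewrite !letter_op_rcons /=.
exact: (base_change_seq_right (fun p => m p.+1)).
Qed.

Local Notation d := (bar_d f N m mG).
Local Notation X := (dsum (bar_page f N Ap G)).

Let inj p : {additive tensor SW sra p -> X} := dsum_inj p.
Local Notation wd := (word_fun (tensor_seq inj)).

Lemma bar_d_inj p (x : bar_page f N Ap G p) :
  d (dsum_inj p x) = \sum_(1 <= i < p.+2) 
    dsum_inj (p.+1 - i)%N (bar_term kz (mbar f m) (mGbar f N mG) i x : bar_page f N Ap G _).
Proof.
apply: dsum_lift_inj => q y z; rewrite -sumrB; apply: eq_bigr => i _.
by rewrite !raddfB.
Qed.

Lemma bar_d_word z : d (wd z) = wdiff ssg sop wd z.
Proof.
case/lastP: z => [|z l]; first by rewrite raddf0 /= addr0.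
rewrite -(wdiff_word (sgn := kz) (mU := mbar f m) (mW := mGbar f N mG)
  (sgnW := id) _ _ _ _ _ _ _ _ (in_tuple z)) //.
- rewrite word_fun_rcons -[map fst z]/(tval [tuple of map fst (in_tuple z)]) (tensor_seqE inj).
  exact: bar_d_inj.
- exact: koszul_bar_additive.
- exact: koszul_barZ.
- exact: koszul_bar_rmul.
- exact: sletter_op_left.
- exact: sletter_op_right.
Qed.

(** Since scalars can be moved to the last factor ([tensor_seq_bgen]), words with scalar 1 in every
    factor and some [n] in the last one suffice to test additive maps on the bar complex. *)
Definition letter_base_change (n : N) (x : V * W) : SV * SW :=
  (bpure f x.1 (1 : S^o), bpure f x.2 n).
Local Notation lb := letter_base_change.

Lemma letter_base_change_additive n : zmod_morphism (lb n).
Proof. by move=> x y; rewrite /lb /= !bpureBl. Qed.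

Lemma letter_base_change_op n z l : lb n (op (rcons z l)) = sop (map (lb n) (rcons z l)).
Proof.
rewrite map_rcons !letter_op_rcons /lb /=.
have -> : map fst (map (lb n) z) = map (bgen f) [seq (x.1, 1) | x <- z].
  by rewrite -!map_comp.
rewrite (base_change_seq f (fun p => m p.+1)) (base_change_seq f (fun p => mG p.+1)).
by rewrite -map_comp big_map big1 ?scale1r.
Qed.

Local Notation bone := (fun v : V => bpure f v (1 : S^o)).

(** The relations over [S] pass [s] from each factor to the next until it acts on [n]. *)
Let tensor_seq_shift (Z : zmodType) (g : forall p, {additive tensor SW sra p -> Z})
    b v s t w n :
  tensor_seq g (b ++ bgen f (v, s) :: map bone t) (bpure f w n) =
  tensor_seq g (b ++ map bone (v :: t)) (bpure f w (s *: n)).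
Proof.
elim: t b v => [|v' t IHt] b v.
  have := tensor_seq_last g b (bone v) s (bpure f w n).
  by rewrite bchange_rmul_pure mul1r bpureZr -!cats1.
have := tensor_seq_mid g b (bone v) s (bone v') (map bone t) (bpure f w n).
rewrite bchange_rmul_pure mul1r bpureZr => ->.
have -> : s *: (1 : S^o) = s by apply: mulr1.
rewrite -cat_rcons.
by rewrite -[bpure f v' _]/(bgen f (v', s)) IHt cat_rcons.
Qed.

Lemma tensor_seq_bgen (Z : zmodType) (g : forall p, {additive tensor SW sra p -> Z}) b t w n :
  tensor_seq g (b ++ map (bgen f) t) (bpure f w n) =
  tensor_seq g (b ++ map bone (map fst t)) (bpure f w ((\prod_(x <- t) x.2) *: n)).
Proof.
elim: t b => [|[v s] t IHt] b; first by rewrite big_nil scale1r.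
by rewrite /= -cat_rcons IHt cat_rcons tensor_seq_shift big_cons scalerA.
Qed.

Hypothesis f_stasheff : forall n z,
  lb n (wdiff sg op op z) = 0.
Hypothesis m_degree : operations_degree m 2.

(** Base change commutes with signs and operations, so the square becomes a word differential over
    [Q] with base change absorbed into [F], and [wdiff_wdiff] applies. *)
Lemma bar_d_square_word n z : d (d (wd (map (lb n) z))) = 0.
Proof.
rewrite bar_d_word raddf_wdiff; under eq_wdiff do rewrite bar_d_word.
have lb_sg x : lb n (sg x) = ssg (lb n x) by rewrite /lb /letter_sgn /= koszul_bar_pure.
have lb_op x y : lb n (op (x :: y)) = sop (map (lb n) (x :: y)).
  by rewrite lastI letter_base_change_op.
rewrite (wdiff_map (sgn := sg) (m := op)) //.
under eq_wdiff do rewrite (wdiff_map (sgn := sg) (m := op)) //.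
have Fadd : multiadditive (fun y => wd (map (lb n) y)).
  move=> b c x y; rewrite !map_cat /= letter_base_change_additive.
  exact: word_fun_additive.
apply: wdiff_wdiff => //.
- by move=> x; rewrite /letter_sgn /= koszulK -surjective_pairing.
- move=> a x b c; rewrite map_cat map_cons f_stasheff -[X in _ ++ X :: _](subrr 0).
  by rewrite word_fun_additive subrr.
move=> a x b y c; set z1 := sg _; set z2 := op _.
(* Only the first components of [z1] and [z2] are known to be opposite. This suffices, as the letter
   [y] follows them. *)
have z12 : z1.1 = (0 - z2).1.
  rewrite /= sub0r.
  have := koszul_operation m_degree (map fst (x :: b)).
  by rewrite /z1 /z2 /letter_op -!map_comp; exact.
rewrite map_cat /= (@eq_word_fun_fst _ _ _ _ _ _ _ (lb n (0 - z2))); last first.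
  exact: (congr1 (fun v => bpure f v (1 : S^o)) z12).
have := Fadd a (y :: c) 0 z2; rewrite /= !map_cat /= => ->.
rewrite subrK; have := Fadd a (y :: c) 0 0; rewrite !subrr map_cat /=; exact.
Qed.

Lemma bar_d_square y : d (d y) = 0.
Proof.
(* Arbitrary tensors are reduced to words in the generators [bgen], whose scalars are then gathered
   into [n]. *)
have ext (g : forall p, {additive tensor SW sra p -> X}) :
  (forall n z, word_fun (tensor_seq g) (map (lb n) z) = 0) ->
    forall p x, g p x = 0.
  move=> g0 p; elim/tensor_ind => [|u v gu gv|v w]; first exact: raddf0.
    by rewrite raddfB gu gv subrr.
  rewrite -(tensor_seqE g).
  elim/bchange_ind: w => [|w w' Ew Ew'|w n].
  - by rewrite -(subrr 0) tensor_seq_addr subrr.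
  - by rewrite tensor_seq_addr Ew Ew' subrr.
  suff E : (fun s => tensor_seq g s (bpure f w n)) =1 (fun=> 0) by apply: E.
  apply: (word_ext sgen_ind) => [b c s s'|b c s s'|t].
  - exact: tensor_seq_addl.
  - by rewrite subrr.
  rewrite (tensor_seq_bgen g [::]).
  have := g0 ((\prod_(x <- t) x.2) *: n) (rcons [seq (x.1, 0) | x <- t] (0, w)).
  by rewrite map_rcons word_fun_rcons -!map_comp.
elim/dsum_ind: y => [|y z dy dz|p x]; first by rewrite !raddf0.
  by rewrite !raddfD dy dz addr0.
pose g p : {additive tensor SW sra p -> X} := (d \o d) \o inj p.
apply: (ext g) => n z; have := bar_d_square_word n z.
case/lastP: z => [|z l]; first by [].
by rewrite map_rcons !word_fun_rcons.
Qed.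

End BarComplexWords.

(** * The spectral sequence of the filtration *)

Section Pages.
Variables (E0 : nat -> zmodType) (d : {additive dsum E0 -> dsum E0}).
Local Notation X := (dsum E0).

Definition coordinate j (y : X) : E0 j := y j.
Fact coordinate_additive j : zmod_morphism (coordinate j).
Proof. by []. Qed.
HB.instance Definition _ j :=
  GRing.isZmodMorphism.Build X (E0 j) (coordinate j) (coordinate_additive j).

Fact component_additive q : zmod_morphism (@component E0 q).
Proof. by case: q => l y z; [apply: (raddfB (dsum_inj l)) | rewrite /= subr0]. Qed.
HB.instance Definition _ q :=
  GRing.isZmodMorphism.Build X X (@component E0 q) (component_additive q).

Lemma component_inj q l (z : E0 l) :
  component q (dsum_inj l z : X) = if q == l%:Z then dsum_inj l z else 0.
Proof.
case: q => [k|k]; rewrite /component //; case: eqP => [[->]|kl]; first by rewrite dsum_injE.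
by rewrite [X in dsum_inj k X]dsum_inj_neq ?raddf0 // => lk; apply: kl; rewrite lk.
Qed.

Lemma component_eq0 l (y : X) : component l%:Z y = 0 -> y l = 0.
Proof. by move=> /(congr1 (fun z : X => z l)); rewrite dsum_injE. Qed.

Definition truncation (p : nat) (x : forall l, E0 l) : X :=
  \sum_(l < p.+1) (dsum_inj (l : nat) (x l) : X).

Lemma truncationE p x j : truncation p x j = if (j <= p)%N then x j else 0.
Proof.
rewrite /truncation -[LHS]/(coordinate j _) raddf_sum.
have inj_j (l : 'I_p.+1) : coordinate j (dsum_inj (l : nat) (x l)) =
    if j == l :> nat then x j else 0.
  rewrite /coordinate; case: eqP => [->|jl]; first by rewrite dsum_injE.
  by rewrite dsum_inj_neq // => lj; apply: jl.
rewrite (eq_bigr _ (fun l _ => inj_j l)).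
case: leqP => jp; last by rewrite big1 // => l _; rewrite gtn_eqF // (leq_trans (ltn_ord l)).
rewrite (bigD1 (Ordinal (jp : (j < p.+1)%N))) //= eqxx big1 ?addr0 // => l.
by rewrite -val_eqE /= eq_sym => /negPf->.
Qed.

Lemma truncation_filtration p x : filtration p%:Z (truncation p x).
Proof. by move=> l; rewrite ltz_nat truncationE leqNgt => pl; rewrite ifN ?negbK. Qed.

Lemma filtration_truncation p (y : X) : filtration p%:Z y -> y = truncation p y.
Proof.
move=> yp; apply: dsumP => j; rewrite truncationE; case: leqP => // pj.
by apply: yp; rewrite ltz_nat.
Qed.

Lemma eq_page_class r p (y z : X) : cycles d r p y -> cycles d r p z ->
  (exists a b, [/\ cycles d (r - 1) (p - 1) a, boundaries d (r - 1) p b & y - z = a + b]) ->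
  page_class d r p y = page_class d r p z.
Proof.
move=> yr zr [a [b [ar br yz]]]; apply: zproj_rel; exists a, b; split=> //.
have cyc u : cycles d r p u -> zval (insubd (0 : zcycles d r p) u) = u.
  by move=> ur; rewrite -[zval _]/(val _) insubdK //; apply/asboolP.
by rewrite -yz -{2}(cyc _ yr) -{2}(cyc _ zr).
Qed.

Lemma filtration_component (p : int) (y z : X) : filtration p y -> filtration p z ->
  component p y = component p z -> filtration (p - 1) (y - z).
Proof.
move=> yp zp yz l pl; rewrite dsumBE.
have [pl'|] := boolP (p < l%:Z); first by rewrite yp // zp // subrr.
rewrite -leNgt => lp; have pE : p = l by lia.
rewrite -dsumBE; apply: component_eq0; rewrite raddfB -pE.
apply/eqP; rewrite subr_eq0; apply/eqP.
exact: yz.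
Qed.

(** Two elements of [Z^r_p] with the same leading component differ by an element of [Z^(r-1)_(p-1)],
    so the chosen lift does not affect the class. *)
Lemma survivor_classE (r p : int) x y : cycles d r p y -> component p y = x ->
  survivor_class d r p x = page_class d r p y.
Proof.
move=> yr yx; rewrite /survivor_class; case: pselect => [xr|[]]; last by exists y.
case: (cid2 xr) => z zr zx /=.
apply: eq_page_class => //; exists (z - y), 0; split; last by rewrite addr0.
  have [zp dz] := zr; have [yp dy] := yr; split.
    by apply: filtration_component => //; rewrite zx yx.
  rewrite (_ : p - 1 - (r - 1) = p - r); last by lia.
  by move=> l pl; rewrite raddfB dsumBE dz // dy // subrr.
by exists 0; [split=> l _; rewrite ?raddf0 | rewrite raddf0].
Qed.

Hypothesis dd : forall y, d (d y) = 0.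

Lemma cycles_d r p y : cycles d r p y -> cycles d r (p - r) (d y).
Proof. by case=> _ dy; split=> // l _; rewrite dd. Qed.

(** The chosen representative differs from [y] by [a + b] with [a] in [Z^(r-1)_(p-1)] and [b] a
    boundary. Then [d b = 0], and [d a] lies in [B^(r-1)_(p-r)]. *)
Lemma page_diffE r p y : cycles d r p y ->
  page_diff (page_class d r p y) = page_class d r (p - r) (d y).
Proof.
move=> yr; rewrite /page_diff; set c := zrepr _.
have cr : cycles d r p (zval c) by apply/asboolP; case: c.
(* The relations already form a subgroup, so an element of their span is itself of the form
   [a + b]. *)
pose D (u : zcycles d r p) := exists a b, [/\ cycles d (r - 1) (p - 1) a,
  boundaries d (r - 1) p b & zval u = a + b].
have /zproj_eq/(_ D) := zreprK (page_class d r p y).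
move=> [||//|a [b [ar [b' br bE] cE]]].
- exists 0, 0; split; rewrite ?addr0 //; first by split=> l _; rewrite ?raddf0.
  by exists 0; [split=> l _; rewrite ?raddf0 | rewrite raddf0].
- move=> u v [a [b [ar [b1 br bE] uE]]] [a' [b' [ar' [b1' br' bE'] vE]]].
  have cycB q k (e e' : X) : cycles d q k e -> cycles d q k e' -> cycles d q k (e - e').
    move=> /asboolP er /asboolP er'; apply/asboolP.
    exact: (rpredB (S := in_cycles d q k)) er er'.
  exists (a - a'), (b - b'); split; first exact: cycB.
    by exists (b1 - b1'); [apply: cycB | rewrite raddfB bE bE'].
  by rewrite -[zval _]/(\val _) raddfB /= uE vE opprD addrACA.
apply: eq_page_class; [exact: cycles_d|exact: cycles_d|].
exists 0, (d a); split; first by split=> l _; rewrite ?raddf0.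
  by exists a => //; rewrite (_ : p - r + (r - 1) = p - 1) //; lia.
have yE : zval (insubd (0 : zcycles d r p) y) = y.
  by rewrite -[zval _]/(val _) insubdK //; apply/asboolP.
move: cE; rewrite -[zval _]/(\val _) raddfB -/c [X in _ - X]yE => cE.
rewrite add0r -raddfB cE.
by rewrite raddfD -bE dd addr0.
Qed.

End Pages.

(** * Differentials that are sums of operators lowering the number of bars *)

Section OperatorSum.
Variables (E0 : nat -> zmodType) (d : {additive dsum E0 -> dsum E0}).
Local Notation X := (dsum E0).
Variable t : nat -> {additive X -> X}.
Hypothesis t_inj : forall i l (z : E0 l), (i <= l.+1)%N ->
  exists u, t i (dsum_inj l z) = dsum_inj (l.+1 - i)%N u.
Hypothesis t_inj0 : forall i l (z : E0 l), (l.+1 < i)%N -> t i (dsum_inj l z) = 0.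
Hypothesis d_inj : forall l (z : E0 l),
  d (dsum_inj l z) = \sum_(1 <= i < l.+2) t i (dsum_inj l z).

(** Only the component of [y] with [p - n - 1 + i] bars is sent by [t i] to [p - n] bars, and [y]
    has none beyond [p], whence [i <= n + 1]. *)
Lemma component_d (p n : nat) (y : X) : filtration p%:Z y ->
  component (p%:Z - n%:Z) (d y) =
  \sum_(1 <= i < n.+2) t i (component (p%:Z - n%:Z - 1 + i%:Z) y).
Proof.
move=> /filtration_truncation ->; rewrite /truncation !raddf_sum.
under [RHS]eq_bigr do rewrite !raddf_sum.
rewrite exchange_big; apply: eq_bigr => -[l lp] _ /=.
rewrite d_inj raddf_sum /=; set z := dsum_inj l _.
pose c i := if (p%:Z - n%:Z - 1 + i%:Z == l%:Z) then t i z else 0.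
(* Both sums are extended by zeros to a common range: [t i] vanishes for [i > l + 1], and for
   [i > n + 1] the index condition in [c] would force [l > p]. *)
have big_c a b : (forall i, (a <= i)%N -> c i = 0) ->
    \sum_(1 <= i < a) c i = \sum_(1 <= i < a + b) c i.
  move=> ca; case: a ca => [|a] ca.
    by rewrite big_geq // big_nat_cond big1 // => i _; apply: ca.
  rewrite [RHS](@big_cat_nat _ _ _ a.+1) ?leq_addr //=.
  rewrite [X in _ = _ + X]big_nat_cond [X in _ = _ + X]big1 ?addr0 //.
  by move=> i /andP[/andP[/ca]].
transitivity (\sum_(1 <= i < l.+2) c i).
  apply: eq_big_nat => i /andP[_ il]; rewrite /c.
  have [u uE] := t_inj (y l) il; rewrite /z uE /= component_inj.
  by congr (if _ then _ else _); apply/eqP/eqP; lia.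
rewrite (big_c l.+2 n.+2) => [|i li]; last by rewrite /c t_inj0 ?if_same.
rewrite addnC -big_c => [|i ni]; last by rewrite /c ifF //; lia.
apply: eq_bigr => i _; rewrite component_inj /c; case: ifP => // _.
by rewrite raddf0; reflexivity.
Qed.

Lemma filtration_d (p : nat) (y : X) : filtration p%:Z y -> filtration p%:Z (d y).
Proof.
move=> /filtration_truncation -> l pl; apply: component_eq0.
rewrite /truncation !raddf_sum big1 // => -[k kp] _ /=.
rewrite -[LHS]/(component l%:Z (d (dsum_inj k (y k)))) d_inj raddf_sum.
rewrite big_nat_cond big1 // => i /andP[/andP[i0 ik] _].
have [u ->] := t_inj (y k) (ik : (i <= k.+1)%N).
by rewrite [LHS]component_inj ifF //; lia.
Qed.

End OperatorSum.

(** * The operators [t_i] on the bar complex *)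

Section BarOperators.
Variables (Q : comPzRingType) (S : pzRingType) (f : algebra_map Q S).
Variables (N : lmodType S) (Ap G : nat -> lmodType Q).
Variables (m : algebra_operations Ap) (mG : module_operations Ap G).
Local Notation E0 := (bar_page f N Ap G).
Local Notation X := (dsum E0).
Local Notation kz := (@koszul_bar _ _ f Ap).

Fact bar_t_additive i : zmod_morphism (bar_t f N m mG i : X -> X).
Proof.
apply: dsum_lift_additive => l y z; case: ifP => _; last by rewrite subr0.
by rewrite !raddfB.
Qed.
HB.instance Definition _ i :=
  GRing.isZmodMorphism.Build X X (bar_t f N m mG i : X -> X) (bar_t_additive i).

Lemma bar_t_inj i l (z : E0 l) : bar_t f N m mG i (dsum_inj l z) =
  if (i <= l.+1)%N then
    dsum_inj (l.+1 - i)%N (bar_term kz (mbar f m) (mGbar f N mG) i z : E0 _)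
  else 0.
Proof.
apply: dsum_lift_inj => q y y'; case: ifP => _; last by rewrite subr0.
by rewrite !raddfB.
Qed.

Lemma bar_op_inj i j l (z : E0 l) : bar_op f N m mG i j (dsum_inj l z) =
  if (i + j <= l.+1)%N then
    dsum_inj (l.+1 - i)%N (bar_insert kz (mbar f m) (mGbar f N mG) l i j z : E0 _)
  else 0.
Proof.
apply: dsum_lift_inj => q y y'; case: ifP => _; last by rewrite subr0.
by rewrite !raddfB.
Qed.

Lemma bar_t_op i l (z : E0 l) : (i <= l.+1)%N ->
  bar_t f N m mG i (dsum_inj l z) =
  \sum_(0 <= j < (l.+1 - i).+1) bar_op f N m mG i j (dsum_inj l z).
Proof.
move=> il; rewrite bar_t_inj il /bar_term raddf_sum.
apply: eq_big_nat => j /andP[_ jl]; rewrite bar_op_inj ifT //.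
by rewrite -leq_subRL.
Qed.

End BarOperators.

Theorem theorem5p5
  (Q R : comPzRingType) (I : set Q) (pi : {rmorphism Q -> R})
  (R_quotient : quotient_by I pi)
  (S : pzRingType) (sigma : algebra_map R S)
  (M : lmodType R) (N : lmodType S)
  (* A_(n+1) is Ap n, and A_0 is Q *)
  (Ap : nat -> lmodType Q)
  (dA : forall n, {linear with_unit Ap n.+1 -> with_unit Ap n})
  (A_resolution : projective_resolution dA (pi : with_unit Ap 0 -> R))
  (G : nat -> lmodType Q) (dG : forall n, {linear G n.+1 -> G n})
  (eps : {linear G 0%N -> M | pi \; *:%R})
  (G_resolution : projective_resolution dG eps)
  (m : algebra_operations Ap) (m_algebra : a_infinity_algebra dA m)
  (mG : module_operations Ap G) (mG_module : a_infinity_module dA dG m mG)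
  (p r : nat)
  (x : bar_page (algebra_map_comp pi sigma) N Ap G p) :
  let f := algebra_map_comp pi sigma in
  let d := bar_d f N m mG in
  let t := bar_t f N m mG in
  let lifts (x_ : forall l, bar_page f N Ap G l) :=
    x_ p = x /\
    forall n, (1 <= n <= r)%N ->
      \sum_(1 <= i < n.+1) t i (extend x_ (p%:Z - n%:Z + i%:Z)) = 0 in
  (survives d r p (dsum_inj p x) <-> exists x_, lifts x_) /\
  forall x_, lifts x_ ->
    let w := \sum_(1 <= i < r.+2) t i (extend x_ (p%:Z - r%:Z - 1 + i%:Z)) in
    [/\ survives d r (p%:Z - r%:Z) w,
        page_diff (survivor_class d r p (dsum_inj p x)) =
          survivor_class d r (p%:Z - r%:Z) w &
        w = \sum_(1 <= i < r.+2) \sum_(0 <= j < p.+1 - r)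
              bar_op f N m mG i j (extend x_ (p%:Z - r%:Z - 1 + i%:Z))].
Proof.
move=> f d t lifts.
have dd y : d (d y) = 0.
  apply: bar_d_square; last by case: m_algebra.
  move=> n z; have -> := wdiff_letter_op A_resolution G_resolution m_algebra mG_module z.
  (* By exactness at [A_0], [d1A] takes values in the kernel of [pi], which kills the remaining
     two-letter terms over [S]. *)
  have f0 v : f (d1A dA v) = 0.
    rewrite /= (_ : pi _ = 0) ?rmorph0 //.
    by apply/(resolution_exact0 A_resolution); exists (v 0%N).
  have lB := letter_base_change_additive f n.
  have l0 : letter_base_change f n (0 : gtotal Ap * gtotal G) = 0.
    by rewrite -(subrr 0) lB !subrr.
  case: z => [|u [|v [|u' z]]] //.
  by apply: injective_projections; rewrite /= ?bpureBl !bpureZ_eq0 ?subrr //; apply: f0.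
have t_inj i l (z : bar_page f N Ap G l) : (i <= l.+1)%N ->
    exists u, t i (dsum_inj l z) = dsum_inj (l.+1 - i)%N u.
  by move=> il; rewrite /t bar_t_inj il; eexists.
have t_inj0 i l (z : bar_page f N Ap G l) : (l.+1 < i)%N -> t i (dsum_inj l z) = 0.
  by move=> li; rewrite /t bar_t_inj leqNgt li.
have d_inj l (z : bar_page f N Ap G l) :
    d (dsum_inj l z) = \sum_(1 <= i < l.+2) t i (dsum_inj l z).
  rewrite /d bar_d_inj; apply: eq_big_nat => i /andP[_ il].
  by rewrite /t bar_t_inj -ltnS il.
have comp n y : filtration p y ->
    component (p%:Z - n%:Z) (d y) =
    \sum_(1 <= i < n.+2) t i (component (p%:Z - n%:Z - 1 + i%:Z) y).
  exact: (component_d (t := fun i => t i) t_inj t_inj0 d_inj).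
have filt y : filtration p y -> filtration p (d y).
  exact: (filtration_d (t := fun i => t i) t_inj d_inj).
(* The family [x_] may be nonzero above [p]; truncation discards this, and the sums involve indices
   up to [p] only. For negative [k] both sides are 0 by convention. *)
have ext (x_ : forall l, bar_page f N Ap G l) k : (k <= p%:Z)%R ->
    component k (truncation p x_) = extend x_ k.
  by case: k => // k kp; rewrite /component /extend truncationE -lez_nat kp.
have compE (x_ : forall l, bar_page f N Ap G l) n :
    component (p%:Z - n%:Z) (d (truncation p x_)) =
    \sum_(1 <= i < n.+2) t i (extend x_ (p%:Z - n%:Z - 1 + i%:Z)).
  rewrite comp; last exact: truncation_filtration.
  by apply: eq_big_nat => i /andP[_ i_n]; rewrite ext //; lia.
have lift_cycles x_ : lifts x_ -> cycles d r p (truncation p x_) /\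
    component p (truncation p x_) = dsum_inj p x.
  move=> [xp x0]; split; last by rewrite ext // /extend xp.
  split; first exact: truncation_filtration.
  (* Above [p] the filtration is preserved by [d]. For [p - r < l <= p] the component at [l] is the
     equation with [n = p - l + 1]. *)
  move=> l pl; have [lp|lp] := leqP l p; last first.
    by apply: filt; [exact: truncation_filtration | rewrite ltz_nat].
  apply: component_eq0; have -> : l%:Z = p%:Z - (p - l)%N%:Z by lia.
  rewrite compE -[RHS](x0 (p - l).+1); last by lia.
  by apply: eq_bigr => i _; congr (t i (extend _ _)); lia.
split.
  split=> [[y [yp dy] yx]|[x_ /lift_cycles[]]]; last by exists (truncation p x_).
  (* The components of [y] solve the system: equation [n.+1] is the component of [d y] at [p - n],
     which is zero because [p - n > p - r], or by convention if [p - n] is negative. *)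
  exists (fun l => y l); split.
    by move: yx => /(congr1 (fun z : dsum _ => z p)); rewrite !dsum_injE.
  move=> [//|n] /andP[_ nr].
  have := comp n y yp.
  have -> : component (p%:Z - n%:Z) (d y) = 0.
    case E: (p%:Z - n%:Z) => [l|//] /=; rewrite dy ?raddf0 //; lia.
  move=> E; rewrite [RHS]E; apply: eq_bigr => i _; congr (t i _).
  rewrite (_ : p%:Z - n.+1%:Z + i%:Z = p%:Z - n%:Z - 1 + i%:Z) //; lia.
move=> x_ xlift w; have [yr yx] := lift_cycles _ xlift.
(* Thus [d] of the truncation is the lift of [w] to a cycle, which gives both survival and the value
   of the page differential. *)
have wE : component (p%:Z - r%:Z) (d (truncation p x_)) = w by rewrite compE.
split.
- by exists (d (truncation p x_)) => //; apply: cycles_d.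
- rewrite (survivor_classE yr yx) (page_diffE dd yr).
  by rewrite (survivor_classE _ wE) //; apply: cycles_d.
apply: eq_big_nat => i /andP[i0 ir].
(* If [r > p] the range of [j] is empty, and the left side vanishes too, since [t i] would have to
   land in the negative number [p - r] of bars. *)
have [rp|pr] := leqP r p; last first.
  rewrite big_geq; last by lia.
  case E: (p%:Z - r%:Z - 1 + i%:Z) => [l|l]; last exact: (raddf0 (bar_t f N m mG i)).
  by rewrite /extend t_inj0 //; lia.
have -> : p%:Z - r%:Z - 1 + i%:Z = (p - r + i.-1)%N by lia.
rewrite /t /extend bar_t_op; last by lia.
by congr (\sum_(0 <= j < _) _); lia.
Qed.
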